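(* Let $U\subseteq\mathbb{C}_{xy}$ be $q$-open and $d,l\in\mathbb{Z}_+$. Consider the sequence $0\to\mathcal{Q}(U)\xrightarrow{\partial^0}\mathcal{Q}(U)\oplus\mathcal{Q}(U)\xrightarrow{\partial^1}\mathcal{Q}(U)\xrightarrow{\pi_{d,l}}\mathcal{O}(U)\to0$, where $\partial^0\zeta=\big((w_1-q^{l+1}w_2)\zeta,\ (z_2-q^{d+1}z_1)\zeta\big)$, $\partial^1(\zeta,\eta)=(z_2-q^dz_1)\zeta+(q^lw_2-w_1)\eta$, and $\pi_{d,l}(\zeta)=\big(\zeta_1(z,q^dz),\ \zeta_4(q^lw,w)\big)$. This is a cochain complex of Fréchet spaces and its cohomology groups $H^0,\dots,H^3$ satisfy: $H^0=\{0\}$ (i.e. $\partial^0$ is injective), $H^1=\ker\partial^1/\operatorname{im}\partial^0$ is topologically isomorphic to $\mathcal{O}(U)$ (in particular $\operatorname{im}\partial^0$ is closed), $H^2=\{0\}$ (i.e. $\operatorname{im}\partial^1=\ker\pi_{d,l}$, in particular closed), and $H^3=\{0\}$ (i.e. $\pi_{d,l}$ is surjective).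
   Context: Fix $q$ with $0<|q|<1$. $V\subseteq\mathbb{C}$ is $q$-open if open, $0\in V$, $qV\subseteq V$. A $q$-open $U\subseteq\mathbb{C}_{xy}=(\mathbb{C}\times\{0\})\cup(\{0\}\times\mathbb{C})$ is $U=U_x\cup U_y$ with $U_x,U_y$ $q$-open subsets of $\mathbb{C}$ (coordinate $z$ on $U_x$, $w$ on $U_y$). $\mathcal{O}(U)=\{(f,g)\in\mathcal{O}(U_x)\oplus\mathcal{O}(U_y):f(0)=g(0)\}$. $\mathcal{Q}(U)$ is the Fréchet space of quadruples $\zeta=(\zeta_1(z_1,z_2),\zeta_2(z_1,w_2),\zeta_3(w_1,z_2),\zeta_4(w_1,w_2))$ with $\zeta_1\in\mathcal{O}(U_x\times U_x)$, $\zeta_2\in\mathcal{O}(U_x\times U_y)$, $\zeta_3\in\mathcal{O}(U_y\times U_x)$, $\zeta_4\in\mathcal{O}(U_y\times U_y)$ satisfying $\zeta_1(z_1,0)=\zeta_2(z_1,0)$, $\zeta_3(w_1,0)=\zeta_4(w_1,0)$, $\zeta_1(0,z_2)=\zeta_3(0,z_2)$, $\zeta_2(0,w_2)=\zeta_4(0,w_2)$ (it is isomorphic to $\mathcal{O}(U)\widehat{\otimes}\mathcal{O}(U)$). The operators $z_1,z_2,w_1,w_2$ on $\mathcal{Q}(U)$ act by: $z_1\zeta=(z_1\zeta_1,z_1\zeta_2,0,0)$, $z_2\zeta=(z_2\zeta_1,0,z_2\zeta_3,0)$, $w_1\zeta=(0,0,w_1\zeta_3,w_1\zeta_4)$, $w_2\zeta=(0,w_2\zeta_2,0,w_2\zeta_4)$.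 *)

(* Defs.v *)
From mathcomp Require Import all_boot all_order all_algebra.
From mathcomp Require Import all_classical all_reals all_analysis.
From mathcomp Require Import complex.
Import Order.TTheory GRing.Theory Num.Theory.
Import numFieldTopology.Exports numFieldNormedType.Exports.

Set Implicit Arguments.
Unset Strict Implicit.
Unset Printing Implicit Defensive.

Local Open Scope ring_scope.
Local Open Scope classical_set_scope.

Notation CC R := ((R[i])^o).

Definition q_open (R : realType) (q : CC R) (V : set (CC R)) : Prop :=
  open V /\ V 0 /\ (forall z, V z -> V (q * z)).

(* holomorphy = complex Frechet differentiability at every point *)
Definition holo1 (R : realType) (D : set (CC R)) (f : CC R -> CC R) : Prop :=
  forall z, D z -> differentiable f z.
Definition holo2 (R : realType) (D : set (CC R * CC R)) (f : CC R * CC R -> CC R) : Prop :=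
  forall p, D p -> differentiable f p.

Definition cpt_in (R : realType) (V : set (CC R)) (K : set (CC R)) : Prop :=
  compact K /\ K `<=` V.

(* O(U), U = U_x \cup U_y : pairs (f, g), f on U_x, g on U_y, f 0 = g 0. *)
Definition Ofun (R : realType) : Type := ((CC R -> CC R) * (CC R -> CC R))%type.

Definition inO (R : realType) (Ux Uy : set (CC R)) (u : Ofun R) : Prop :=
  [/\ holo1 Ux u.1, holo1 Uy u.2 & u.1 0 = u.2 0].

(* equality of elements of O(U) (functions only matter on their domains) *)
Definition eqO (R : realType) (Ux Uy : set (CC R)) (u v : Ofun R) : Prop :=
  (forall z, Ux z -> u.1 z = v.1 z) /\ (forall w, Uy w -> u.2 w = v.2 w).

(* basic 0-neighbourhoods of the Frechet topology (uniform convergence on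
   compacta): for compacts K in U_x, L in U_y and e > 0, |f| <= e on K and
   |g| <= e on L. *)
Definition nbO (R : realType) (K L : set (CC R)) (e : CC R) (u : Ofun R) : Prop :=
  (forall z, K z -> `|u.1 z| <= e) /\ (forall w, L w -> `|u.2 w| <= e).

(* Q(U) : quadruples (zeta1(z1,z2), zeta2(z1,w2), zeta3(w1,z2), zeta4(w1,w2)) *)
Record Quad (R : realType) := mkQuad {
  qc1 : CC R * CC R -> CC R;
  qc2 : CC R * CC R -> CC R;
  qc3 : CC R * CC R -> CC R;
  qc4 : CC R * CC R -> CC R }.

Definition inQ (R : realType) (Ux Uy : set (CC R)) (x : Quad R) : Prop :=
  [/\ holo2 (Ux `*` Ux) (qc1 x), holo2 (Ux `*` Uy) (qc2 x),
      holo2 (Uy `*` Ux) (qc3 x), holo2 (Uy `*` Uy) (qc4 x) &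
      [/\ forall z1, Ux z1 -> qc1 x (z1, 0) = qc2 x (z1, 0),
          forall w1, Uy w1 -> qc3 x (w1, 0) = qc4 x (w1, 0),
          forall z2, Ux z2 -> qc1 x (0, z2) = qc3 x (0, z2) &
          forall w2, Uy w2 -> qc2 x (0, w2) = qc4 x (0, w2)]].

Definition eqQ (R : realType) (Ux Uy : set (CC R)) (x y : Quad R) : Prop :=
  [/\ forall p, (Ux `*` Ux) p -> qc1 x p = qc1 y p,
      forall p, (Ux `*` Uy) p -> qc2 x p = qc2 y p,
      forall p, (Uy `*` Ux) p -> qc3 x p = qc3 y p &
      forall p, (Uy `*` Uy) p -> qc4 x p = qc4 y p].

(* basic 0-neighbourhoods (compacts K in U_x, L in U_y; compacts of the
   products U_x*U_x etc. are contained in such K*K, K*L, L*K, L*L) *)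
Definition nbQ (R : realType) (K L : set (CC R)) (e : CC R) (x : Quad R) : Prop :=
  [/\ forall p, (K `*` K) p -> `|qc1 x p| <= e,
      forall p, (K `*` L) p -> `|qc2 x p| <= e,
      forall p, (L `*` K) p -> `|qc3 x p| <= e &
      forall p, (L `*` L) p -> `|qc4 x p| <= e].

Definition zeroQ (R : realType) : Quad R :=
  mkQuad (fun _ => 0) (fun _ => 0) (fun _ => 0) (fun _ => 0).
Definition addQ (R : realType) (x y : Quad R) : Quad R :=
  mkQuad (fun p => qc1 x p + qc1 y p) (fun p => qc2 x p + qc2 y p)
         (fun p => qc3 x p + qc3 y p) (fun p => qc4 x p + qc4 y p).
Definition scaleQ (R : realType) (a : CC R) (x : Quad R) : Quad R :=
  mkQuad (fun p => a * qc1 x p) (fun p => a * qc2 x p)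
         (fun p => a * qc3 x p) (fun p => a * qc4 x p).
Definition subQ (R : realType) (x y : Quad R) : Quad R := addQ x (scaleQ (-1) y).

Definition mz1 (R : realType) (x : Quad R) : Quad R :=
  mkQuad (fun p => p.1 * qc1 x p) (fun p => p.1 * qc2 x p) (fun _ => 0) (fun _ => 0).
Definition mz2 (R : realType) (x : Quad R) : Quad R :=
  mkQuad (fun p => p.2 * qc1 x p) (fun _ => 0) (fun p => p.2 * qc3 x p) (fun _ => 0).
Definition mw1 (R : realType) (x : Quad R) : Quad R :=
  mkQuad (fun _ => 0) (fun _ => 0) (fun p => p.1 * qc3 x p) (fun p => p.1 * qc4 x p).
Definition mw2 (R : realType) (x : Quad R) : Quad R :=
  mkQuad (fun _ => 0) (fun p => p.2 * qc2 x p) (fun _ => 0) (fun p => p.2 * qc4 x p).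

Definition QQ (R : realType) : Type := (Quad R * Quad R)%type.
Definition inQQ (R : realType) (Ux Uy : set (CC R)) (x : QQ R) : Prop :=
  inQ Ux Uy x.1 /\ inQ Ux Uy x.2.
Definition eqQQ (R : realType) (Ux Uy : set (CC R)) (x y : QQ R) : Prop :=
  eqQ Ux Uy x.1 y.1 /\ eqQ Ux Uy x.2 y.2.
Definition nbQQ (R : realType) (K L : set (CC R)) (e : CC R) (x : QQ R) : Prop :=
  nbQ K L e x.1 /\ nbQ K L e x.2.
Definition addQQ (R : realType) (x y : QQ R) : QQ R := (addQ x.1 y.1, addQ x.2 y.2).
Definition scaleQQ (R : realType) (a : CC R) (x : QQ R) : QQ R :=
  (scaleQ a x.1, scaleQ a x.2).
Definition subQQ (R : realType) (x y : QQ R) : QQ R := (subQ x.1 y.1, subQ x.2 y.2).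

Definition del0 (R : realType) (q : CC R) (l d : nat) (x : Quad R) : QQ R :=
  (subQ (mw1 x) (scaleQ (q ^+ l.+1) (mw2 x)),
   subQ (mz2 x) (scaleQ (q ^+ d.+1) (mz1 x))).

Definition del1 (R : realType) (q : CC R) (l d : nat) (x : QQ R) : Quad R :=
  addQ (subQ (mz2 x.1) (scaleQ (q ^+ d) (mz1 x.1)))
       (subQ (scaleQ (q ^+ l) (mw2 x.2)) (mw1 x.2)).

Definition pi_dl (R : realType) (q : CC R) (d l : nat) (x : Quad R) : Ofun R :=
  (fun z => qc1 x (z, q ^+ d * z), fun w => qc4 x (q ^+ l * w, w)).

(* continuity at 0 (= continuity, for linear maps) between two of the spaces
   above, each given by its membership predicate and basic 0-neighbourhoods *)
Definition lin_continuous (R : realType) (Ux Uy : set (CC R)) (X Y : Type)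
  (inX : X -> Prop) (nbX : set (CC R) -> set (CC R) -> CC R -> X -> Prop)
  (nbY : set (CC R) -> set (CC R) -> CC R -> Y -> Prop) (T : X -> Y) : Prop :=
  forall K L e, cpt_in Ux K -> cpt_in Uy L -> 0 < e ->
    exists K' L' d, [/\ cpt_in Ux K', cpt_in Uy L', 0 < d &
      forall x, inX x -> nbX K' L' d x -> nbY K L e (T x)].

Definition lin_open (R : realType) (Ux Uy : set (CC R)) (X Y : Type)
  (inX : X -> Prop) (nbX : set (CC R) -> set (CC R) -> CC R -> X -> Prop)
  (inY : Y -> Prop) (nbY : set (CC R) -> set (CC R) -> CC R -> Y -> Prop)
  (eqY : Y -> Y -> Prop) (T : X -> Y) : Prop :=
  forall K L e, cpt_in Ux K -> cpt_in Uy L -> 0 < e ->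
    exists K' L' d, [/\ cpt_in Ux K', cpt_in Uy L', 0 < d &
      forall y, inY y -> nbY K' L' d y ->
        exists x, [/\ inX x, nbX K L e x & eqY (T x) y]].

(* sequential closedness in Q(U)+Q(U) (a Frechet, hence metrizable, space) *)
Definition closedQQ (R : realType) (Ux Uy : set (CC R)) (S : QQ R -> Prop) : Prop :=
  forall (u : nat -> QQ R) (x : QQ R),
    (forall n, inQQ Ux Uy (u n) /\ S (u n)) -> inQQ Ux Uy x ->
    (forall K L e, cpt_in Ux K -> cpt_in Uy L -> 0 < e ->
       exists N, forall n, (N <= n)%N -> nbQQ K L e (subQQ (u n) x)) ->
    S x.

Definition lincombO (R : realType) (a : CC R) (u : Ofun R) (b : CC R) (v : Ofun R) : Ofun R :=
  (fun z => a * u.1 z + b * v.1 z, fun w => a * u.2 w + b * v.2 w).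

(* Main.v *)
(* All analytic input is the division of a holomorphic function of two variables
   by z2 - c z1 when it vanishes on the line z2 = c z1, together with a sup-norm
   bound for the quotient of f by z when f 0 = 0.  As holomorphic means only
   complex differentiable, these are obtained as follows.  Goursat's bisection,
   carried out in the logarithmic coordinate p + e^(s + i t), shows that the mean
   of Re h over circles about p does not depend on the radius, even if h is only
   continuous at p.  This gives the maximum modulus principle with finitely many
   exceptional points, which applies to difference quotients: they are bounded,
   then Lipschitz, so that isolated singularities of continuous functions are
   removable and a bounded separately holomorphic function is holomorphic.

   On ker d1, with x = (zeta, eta), one has zeta_1 = eta_4 = 0,
   zeta_2 = w2 f2, eta_2 = q^(d-l) z1 f2, zeta_3 = w1 f3 and eta_3 = z2 f3, and the
   isomorphism of H^1 onto O(U) is induced by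
   x |-> (q^(l-d) eta_1(z, q^(d+1) z) / z, zeta_4(q^(l+1) w, w) / w).
   The two components agree at 0 because both derivatives are determined by
   f2(0,0) and f3(0,0); they vanish exactly when eta_1 and zeta_4 are divisible by
   z2 - q^(d+1) z1 and w1 - q^(l+1) w2.  The maps h1_map and pi have explicit
   continuous right inverses. *)
Require Import Defs.
From HB Require Import structures.
From mathcomp Require Import all_boot all_order all_algebra.
From mathcomp Require Import all_classical all_reals all_analysis.
From mathcomp Require Import ring lra.
From mathcomp Require Import complex.
Import Order.TTheory GRing.Theory Num.Theory.
Import numFieldTopology.Exports numFieldNormedType.Exports.
Local Open Scope ring_scope.
Local Open Scope classical_set_scope.

(** * The modulus and epsilon-delta forms of complex differentiability *)

Section Modulus.
Variable R : realType.
Implicit Types (z w : CC R) (e r : R).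

(** The obstacle is that the quotient by [z2 - c z1] is, on the line itself, a derivative in one
    variable, whose joint holomorphy is proved here without Cauchy's formula or power series.
    Integration serves once: in the coordinate [s + i t] circles become vertical segments, so
    Goursat is needed on rectangles only, and periodicity removes the other two edges. The rest
    compares suprema. A bound [M] on a disc of radius [r] gives the bound [4 M / r] for difference
    quotients centred in the half disc, and a second application makes these quotients Lipschitz.
    Each quotient is continuous at its centre before it is known to be differentiable there, which
    is why the maximum principle has to tolerate exceptional points. A preimage under [del0] of an
    element of the kernel has its second and third components forced, [- q^(-l-1) f2] and [f3]; the
    two divisibilities are the only obstruction. Thus the image of [del0] is the zero set of a
    continuous map on a closed subspace, and it is closed without any estimate on preimages. *)

Definition cmod (z : CC R) : R := complex.Re `|z|.

Lemma cmodE z : `|z| = (cmod z)%:C%C.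
Proof. by rewrite /cmod; case: z => a b. Qed.

Lemma cmod_ge0 z : 0 <= cmod z.
Proof. by rewrite -lecR -cmodE normr_ge0. Qed.

Lemma cmod0 : cmod 0 = 0.
Proof. by apply: (@complexI R); rewrite -cmodE normr0. Qed.

Lemma cmod1 : cmod 1 = 1.
Proof. by apply: (@complexI R); rewrite -cmodE normr1. Qed.

Lemma cmod_eq0 z : (cmod z == 0) = (z == 0).
Proof.
apply/eqP/eqP => [h|->]; last exact: cmod0.
by apply/eqP; rewrite -normr_eq0 cmodE h.
Qed.

Lemma cmod_gt0 z : (0 < cmod z) = (z != 0).
Proof. by rewrite lt_def cmod_eq0 cmod_ge0 andbT. Qed.

Lemma cmodM z w : cmod (z * w) = cmod z * cmod w.
Proof. by apply: (@complexI R); rewrite rmorphM /= -!cmodE normrM. Qed.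

Lemma cmodV z : cmod z^-1 = (cmod z)^-1.
Proof. by apply: (@complexI R); rewrite fmorphV /= -!cmodE normfV. Qed.

Lemma cmodN z : cmod (- z) = cmod z.
Proof. by rewrite /cmod normrN. Qed.

Lemma cmodB z w : cmod (z - w) = cmod (w - z).
Proof. by rewrite -cmodN opprB. Qed.

Lemma cmodD z w : cmod (z + w) <= cmod z + cmod w.
Proof. by rewrite -lecR rmorphD /= -!cmodE ler_normD. Qed.

Lemma cmod_dist w z : cmod z <= cmod (z - w) + cmod w.
Proof. by rewrite -{1}(subrK w z) cmodD. Qed.

Lemma cmod_sqr z : cmod z ^+ 2 = complex.Re z ^+ 2 + complex.Im z ^+ 2.
Proof. by apply: (@complexI R); rewrite rmorphXn /= -cmodE -add_Re2_Im2. Qed.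

Lemma cmodR (x : R) : cmod (x%:C)%C = `|x|.
Proof. by rewrite /cmod /= expr0n addr0 sqrtr_sqr. Qed.

Lemma ReD z w : complex.Re (z + w) = complex.Re z + complex.Re w.
Proof. by case: z w => [a b] [c d]. Qed.

Lemma ImD z w : complex.Im (z + w) = complex.Im z + complex.Im w.
Proof. by case: z w => [a b] [c d]. Qed.

Lemma ReN z : complex.Re (- z) = - complex.Re z.
Proof. by case: z. Qed.

Lemma ImN z : complex.Im (- z) = - complex.Im z.
Proof. by case: z. Qed.

Lemma ReM z w : complex.Re (z * w) =
  complex.Re z * complex.Re w - complex.Im z * complex.Im w.
Proof. by case: z w => [a b] [c d]. Qed.

Lemma ImM z w : complex.Im (z * w) =
  complex.Re z * complex.Im w + complex.Im z * complex.Re w.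
Proof. by case: z w => [a b] [c d]. Qed.

Lemma normRe_le z : `|complex.Re z| <= cmod z.
Proof.
rewrite -ler_sqr ?nnegrE ?cmod_ge0 // cmod_sqr real_normK ?num_real //.
by rewrite lerDl sqr_ge0.
Qed.

Lemma normIm_le z : `|complex.Im z| <= cmod z.
Proof.
rewrite -ler_sqr ?nnegrE ?cmod_ge0 // cmod_sqr real_normK ?num_real //.
by rewrite lerDr sqr_ge0.
Qed.

Lemma cmod_leRI z : cmod z <= `|complex.Re z| + `|complex.Im z|.
Proof.
rewrite -ler_sqr ?nnegrE ?cmod_ge0 ?addr_ge0 // cmod_sqr sqrrD.
by rewrite !real_normK ?num_real // lerD2r lerDl mulrn_wge0 ?mulr_ge0.
Qed.

Lemma gt0c_real (e : CC R) : 0 < e -> exists2 r, 0 < r & e = (r%:C)%C.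
Proof.
by rewrite ltcE /= => /andP[/eqP h h0]; exists (complex.Re e) => //; case: e h {h0} => a b /= ->.
Qed.

Lemma nbhs_cmodP z (P : set (CC R)) :
  nbhs z P <-> exists2 e, 0 < e & forall w, cmod (w - z) < e -> P w.
Proof.
split.
  move=> /nbhs_ballP[e /= /gt0c_real[r r0 ->]] eP; exists r => // w wz.
  by apply: eP; rewrite /ball /= distrC cmodE ltcR.
case=> e e0 eP; apply/nbhs_ballP; exists (e%:C)%C => /=; first by rewrite ltcR.
by move=> w; rewrite /ball /= distrC cmodE ltcR => /eP.
Qed.

Lemma nbhs2_cmodP (p : CC R * CC R) (P : set (CC R * CC R)) :
  nbhs p P <-> exists2 e : R, 0 < e &
    forall v : CC R * CC R, cmod (v.1 - p.1) < e -> cmod (v.2 - p.2) < e -> P v.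
Proof.
split.
  move=> [[A B] /= [/nbhs_cmodP[e e0 eA] /nbhs_cmodP[d d0 dB]] AB].
  exists (Num.min e d); first by rewrite lt_min e0.
  by move=> v; rewrite !lt_min => /andP[w1 _] /andP[_ w2]; apply: AB; split; [apply: eA|apply: dB].
case=> e e0 eP; exists ([set w | cmod (w - p.1) < e], [set w | cmod (w - p.2) < e]) => /=.
  by split; apply/nbhs_cmodP; exists e.
by move=> v [/= w1 w2]; apply: eP.
Qed.

Lemma open_cmodP (A : set (CC R)) : open A <->
  forall z, A z -> exists2 e, 0 < e & forall w, cmod (w - z) < e -> A w.
Proof.
rewrite openE; split => h z /h; first by move=> /nbhs_cmodP.
by move=> ?; apply/nbhs_cmodP.
Qed.

Lemma continuous_cmodP (f : CC R -> CC R) z : {for z, continuous f} <->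
  forall e, 0 < e -> exists2 d, 0 < d & forall w, cmod (w - z) < d -> cmod (f w - f z) < e.
Proof.
split.
  move=> cf e e0.
  have /nbhs_cmodP[d d0 dP] : nbhs z (f @^-1` [set w | cmod (w - f z) < e]).
    by apply: cf; apply/nbhs_cmodP; exists e.
  by exists d.
move=> h P /nbhs_cmodP[e e0 eP]; apply/nbhs_cmodP.
by have [d d0 dP] := h _ e0; exists d => // w /dP /eP.
Qed.

(** The error is bounded by [e * cmod h] instead of dividing by [h], so that expansions can be added
    and composed directly. *)
Definition has_cderiv (f : CC R -> CC R) z (a : CC R) := forall e, 0 < e ->
  exists2 d, 0 < d & forall h, cmod h < d -> cmod (f (z + h) - f z - a * h) <= e * cmod h.

Lemma has_cderiv_differentiable (f : CC R -> CC R) z a :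
  has_cderiv f z a -> differentiable f z.
Proof.
move=> fa; apply/derivable1_diffP/cvg_ex; exists a.
apply/cvgrPdist_le => _ /gt0c_real[e e0 ->]; have [d d0 dP] := fa _ e0.
rewrite near_withinE; apply/nbhs_cmodP; exists d => // h; rewrite subr0 => hd h0.
rewrite /= cmodE lecR; have h0' : 0 < cmod h by rewrite cmod_gt0.
rewrite -(ler_pM2r h0') -cmodM; apply: le_trans (dP _ hd).
rewrite -[X in _ <= X]cmodN; rewrite le_eqVlt; apply/orP; left; apply/eqP; congr cmod.
rewrite mulrBl [_ *: _]mulrC -mulrA mulVf // mulr1 [h *: 1]mulr1 (addrC h).
by rewrite (opprB _ (a * h)).
Qed.

Lemma differentiable_has_cderiv (f : CC R -> CC R) z :
  differentiable f z -> has_cderiv f z ('D_1 f z).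
Proof.
move=> /derivable1_diffP df e e0.
have /cvgrPdist_le/(_ (e%:C)%C) := df; rewrite ltcR => /(_ e0).
rewrite near_withinE => /nbhs_cmodP[d d0 dP]; exists d => // h hd.
have [->|h0] := eqVneq h 0.
  by rewrite addr0 mulr0 subrr subr0 cmod0 mulr0.
have := dP h; rewrite subr0 => /(_ hd h0) /=.
rewrite cmodE lecR; have h0' : 0 < cmod h by rewrite cmod_gt0.
rewrite -(ler_pM2r h0') -cmodM; apply: le_trans.
rewrite -[X in X <= _]cmodN; rewrite le_eqVlt; apply/orP; left; apply/eqP; congr cmod.
rewrite mulrBl [_ *: _]mulrC -mulrA mulVf // mulr1 [h *: 1]mulr1 (addrC h).
by rewrite (opprB _ ('D_1 f z * h)).
Qed.

Lemma has_cderiv2_differentiable (F : CC R * CC R -> CC R) z w a b :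
  (forall e, 0 < e -> exists2 d, 0 < d & forall h k, cmod h < d -> cmod k < d ->
    cmod (F (z + h, w + k) - F (z, w) - a * h - b * k) <= e * (cmod h + cmod k)) ->
  differentiable F (z, w).
Proof.
move=> hF.
pose L (u : CC R * CC R) : CC R := a * u.1 + b * u.2.
have Llin : linear L.
  by move=> c u v; rewrite /L /= !mulrDr scalerDr -!scalerAr addrACA.
pose LL : {linear (CC R * CC R)%type -> CC R} := HB.pack L (GRing.isLinear.Build (R[i]) (CC R * CC R)%type (CC R) _ L Llin).
have Lc : continuous LL.
  move=> u; apply: (@cvgD _ (CC R)); apply: (@cvgM (R[i])).
  - exact: cvg_cst.
  - exact: cvg_fst.
  - exact: cvg_cst.
  - exact: cvg_snd.
have H : F \o shift (z, w) = cst (F (z, w)) + LL +o_ (nbhs (0 : CC R * CC R)) id.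
  apply/eqaddoP => _ /gt0c_real[e e0 ->].
  (* The product carries the maximum norm, and [cmod h + cmod k] is at most twice that norm. *)
  have e20 : 0 < e / 2 by rewrite divr_gt0.
  have [d d0 dP] := hF _ e20.
  apply/nbhs2_cmodP; exists d => // -[h k] /=; rewrite !subr0 => hd kd.
  have := dP h k hd kd => /=.
  rewrite -lecR => /le_trans E; rewrite /= /shift /= /L /= !addrfctE opprfctE /=.
  have -> : `|F (h + z, k + w) - (F (z, w) + (a * h + b * k))| =
     (cmod (F (z + h, w + k) - F (z, w) - a * h - b * k))%:C%C.
    by rewrite -cmodE (addrC h) (addrC k) opprD addrA opprD addrA.
  apply: E; rewrite prod_normE /= !cmodE /Order.max ltcR -fun_if -rmorphM lecR.
  case: ltP => hk; rewrite -mulrA ler_pM2l // ler_pdivrMl //; lra.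
apply/diff_locallyP; split; rewrite (diff_unique Lc H) //.
Qed.
End Modulus.
Arguments cmod {R} z.
Arguments has_cderiv {R} f z a.

(** * Integrals over segments *)

Section SegmentIntegral.
Variable R : realType.
Implicit Types (f g : R -> R) (a b c k M : R).
Local Notation mu := (@lebesgue_measure R).

Definition seg_integral f a b : R := \int[mu]_(x in `[a, b]) f x.
Local Notation I := seg_integral.

Definition seg_continuous f a b := forall x, a <= x <= b -> {for x, continuous f}.

Lemma seg_integrable f a b : seg_continuous f a b -> mu.-integrable `[a, b] (EFin \o f).
Proof.
move=> cf; apply: continuous_compact_integrable; first exact: segment_compact.
apply: continuous_in_subspaceT => x; rewrite inE /= in_itv /= => xab.
exact: cf.
Qed.

Lemma seg_integral_const k a b : a <= b -> I (fun=> k) a b = k * (b - a).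
Proof.
move=> ab; rewrite /I Rintegral_cst //= lebesgue_measure_itv /= lte_fin.
by case: ltgtP ab => //= -> _; rewrite ?subrr.
Qed.

Lemma seg_integral_le f k a b : a <= b -> seg_continuous f a b ->
  (forall x, a <= x <= b -> f x <= k) -> I f a b <= k * (b - a).
Proof.
move=> ab cf fk; rewrite -seg_integral_const //; apply: le_Rintegral => //.
- exact: seg_integrable.
- by apply: seg_integrable => x _; apply: cst_continuous.
Qed.

Lemma seg_integral_ge f k a b : a <= b -> seg_continuous f a b ->
  (forall x, a <= x <= b -> k <= f x) -> k * (b - a) <= I f a b.
Proof.
move=> ab cf fk; rewrite -seg_integral_const //; apply: le_Rintegral => //.
- by apply: seg_integrable => x _; apply: cst_continuous.
- exact: seg_integrable.
Qed.

Lemma seg_integral_near f k M a b : a <= b -> seg_continuous f a b ->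
  (forall x, a <= x <= b -> `|f x - k| <= M) -> `|I f a b - k * (b - a)| <= M * (b - a).
Proof.
move=> ab cf fk.
have h1 : I f a b <= (k + M) * (b - a).
  by apply: seg_integral_le => // x /fk; rewrite ler_norml; lra.
have h2 : (k - M) * (b - a) <= I f a b.
  by apply: seg_integral_ge => // x /fk; rewrite ler_norml; lra.
rewrite ler_norml; lra.
Qed.

Lemma seg_integralB f g a b : seg_continuous f a b -> seg_continuous g a b ->
  I (fun x => f x - g x) a b = I f a b - I g a b.
Proof. by move=> cf cg; apply: RintegralB => //; apply: seg_integrable. Qed.

Lemma seg_integral_split f a b c : a <= c -> c <= b -> seg_continuous f a b ->
  I f a b = I f a c + I f c b.
Proof.
move=> ac cb cf; have fi := seg_integrable _ _ _ cf.
have e : `[a, b]%classic = `[a, c] `|` `]c, b] :> set R.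
  by rewrite -itv_bndbnd_setU // bnd_simp.
have fc : seg_continuous f c b by move=> x /andP[cx xb]; apply: cf; rewrite xb (le_trans ac).
have icb : mu.-integrable `]c, b] (EFin \o f).
  by apply: integrableS fi => // x /=; rewrite !in_itv /= => /andP[/ltW cx ->]; rewrite (le_trans ac).
rewrite /I e Rintegral_setU //.
- by rewrite Rintegral_itv_obnd_cbnd.
- by rewrite -e.
- apply/disj_setPLR => x /=; rewrite !in_itv /= => /andP[_ xc] /andP[cx _].
  by move: (lt_le_trans cx xc); rewrite ltxx.
Qed.
End SegmentIntegral.

(** * Goursat's theorem on rectangles *)

Lemma continuous_shiftP (R : realType) (f : R -> R) (x : R) :
  (forall e, 0 < e -> exists2 d, 0 < d & forall h, `|h| < d -> `|f (x + h) - f x| <= e) ->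
  {for x, continuous f}.
Proof.
move=> hf; apply/cvgrPdist_le => e /hf[d d0 dP]; near=> y.
have : `|y - x| < d by rewrite distrC; near: y; apply: cvgr_dist_lt.
by move=> /dP; rewrite (addrC x) subrK distrC.
Unshelve. all: by end_near.
Qed.

Section Goursat.
Variables (R : realType) (s1 : R) (u v : R -> R -> R).
Implicit Types (a b c d e s t : R).
Local Notation I := (@seg_integral R).

(* Real form of complex differentiability of [u + i v] at [s + i t], with
   derivative [al + i be]. *)
Hypothesis uv_diff : forall s t, s < s1 -> exists al be : R, forall e, 0 < e ->
  exists2 dl, 0 < dl & forall x y, `|x| < dl -> `|y| < dl ->
    `|u (s + x) (t + y) - u s t - (al * x - be * y)| <= e * (`|x| + `|y|) /\
    `|v (s + x) (t + y) - v s t - (be * x + al * y)| <= e * (`|x| + `|y|).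

Lemma cauchy_riemann_continuous s t : s < s1 -> {for t, continuous (u s)}.
Proof.
move=> ss; have [al [be h]] := uv_diff s t ss.
have [dl dl0 dP] := h 1 ltr01; apply: continuous_shiftP => e e0.
have b0 : 0 < 1 + `|be| by rewrite ltr_wpDr.
exists (Num.min dl (e / (1 + `|be|))); first by rewrite lt_min dl0 divr_gt0.
move=> y; rewrite lt_min => /andP[yd]; rewrite ltr_pdivlMr // => ye.
have := dP 0 y; rewrite normr0 addr0 mulr0 !add0r mul1r => /(_ dl0 yd)[+ _].
have : `|be * y| <= `|be| * `|y| by rewrite normrM.
rewrite !ler_norml; lra.
Qed.

Let v_cont s t : s < s1 -> {for s, continuous (v^~ t)}.
Proof.
move=> ss; have [al [be h]] := uv_diff s t ss.
have [dl dl0 dP] := h 1 ltr01; apply: continuous_shiftP => e e0.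
have b0 : 0 < 1 + `|be| by rewrite ltr_wpDr.
exists (Num.min dl (e / (1 + `|be|))); first by rewrite lt_min dl0 divr_gt0.
move=> y; rewrite lt_min => /andP[yd]; rewrite ltr_pdivlMr // => ye.
have := dP y 0; rewrite normr0 !mulr0 !addr0 mul1r => /(_ yd dl0)[_].
have : `|be * y| <= `|be| * `|y| by rewrite normrM.
rewrite !ler_norml; lra.
Qed.

(** This is the imaginary part of the contour integral of [u + i v] over the counterclockwise
    boundary of the rectangle [[a, b] x [c, d]]. *)
Definition rect_integral a b c d : R :=
  (I (u b) c d - I (u a) c d) - (I (v^~ d) a b - I (v^~ c) a b).
Local Notation E := rect_integral.

Lemma rect_integral_splitl a m b c d : a <= m -> m <= b -> b < s1 -> c <= d ->
  E a b c d = E a m c d + E m b c d.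
Proof.
move=> am mb bs cd; rewrite /E.
have cv t : seg_continuous _ (v^~ t) a b.
  by move=> s /andP[_ sb]; apply: v_cont; apply: le_lt_trans bs.
rewrite (seg_integral_split _ (v^~ d) a b m) // (seg_integral_split _ (v^~ c) a b m) //; lra.
Qed.

Lemma rect_integral_splitr a b c m d : a <= b -> b < s1 -> c <= m -> m <= d ->
  E a b c d = E a b c m + E a b m d.
Proof.
move=> ab bs cm md; rewrite /E.
have cu s : s < s1 -> seg_continuous _ (u s) c d by move=> ss t _; apply: cauchy_riemann_continuous.
have as1 := le_lt_trans ab bs.
rewrite (seg_integral_split _ (u a) c d m) ?(seg_integral_split _ (u b) c d m) //; try exact: cu; lra.
Qed.

(** Opposite edges are paired. The main terms [al * (b - a)] and [al * (d - c)] both integrate to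
    [al * (b - a) * (d - c)] and cancel; that the same [al] occurs in both is one of the
    Cauchy-Riemann equations. *)
Lemma rect_integral_near a b c d al M : a <= b -> b < s1 -> c <= d ->
  (forall t, c <= t <= d -> `|u b t - u a t - al * (b - a)| <= M) ->
  (forall s, a <= s <= b -> `|v s d - v s c - al * (d - c)| <= M) ->
  `|E a b c d| <= M * ((b - a) + (d - c)).
Proof.
move=> ab bs cd hu hv; have as1 := le_lt_trans ab bs.
have cu s : s < s1 -> seg_continuous _ (u s) c d by move=> ss t _; apply: cauchy_riemann_continuous.
have cv t : seg_continuous _ (v^~ t) a b.
  by move=> s /andP[_ sb]; apply: v_cont; apply: le_lt_trans bs.
rewrite /E -!seg_integralB //; try exact: cu; try exact: cv.
have cB (f g : R -> R) x y : seg_continuous _ f x y -> seg_continuous _ g x y ->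
    seg_continuous _ (fun z => f z - g z) x y.
  by move=> cf cg z zxy; apply: (@continuousB _ R^o); [apply: cf|apply: cg].
have := seg_integral_near _ _ _ _ _ _ cd (cB _ _ _ _ (cu _ bs) (cu _ as1)) hu.
have := seg_integral_near _ _ _ _ _ _ ab (cB _ _ _ _ (cv d) (cv c)) hv.
rewrite !ler_norml; lra.
Qed.

Lemma rect_integral_bisect a b c d : a <= b -> b < s1 -> c <= d ->
  exists a' b' c' d', [/\ a <= a', b' <= b, c <= c', d' <= d &
    [/\ b' - a' = (b - a) / 2, d' - c' = (d - c) / 2 &
        `|E a b c d| <= 4 * `|E a' b' c' d'|]].
Proof.
move=> ab bs cd; pose m := (a + b) / 2; pose n := (c + d) / 2.
have [am mb cn nd] : [/\ a <= m, m <= b, c <= n & n <= d].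
  by rewrite /m /n; split; lra.
have [am2 mb2] : m - a = (b - a) / 2 /\ b - m = (b - a) / 2 by rewrite /m; split; field.
have [cn2 nd2] : n - c = (d - c) / 2 /\ d - n = (d - c) / 2 by rewrite /n; split; field.
have ms := le_lt_trans mb bs.
have dec : E a b c d = E a m c n + E a m n d + (E m b c n + E m b n d).
  rewrite (rect_integral_splitl a m b c d) // (rect_integral_splitr a m c n d) //.
  by rewrite (rect_integral_splitr m b c n d).
have tri : `|E a b c d| <= `|E a m c n| + `|E a m n d| + (`|E m b c n| + `|E m b n d|).
  by rewrite dec; apply: le_trans (ler_normD _ _) (lerD (ler_normD _ _) (ler_normD _ _)).
have [h1|h1] := leP `|E a b c d| (4 * `|E a m c n|).
  by exists a, m, c, n; split=> //; split.
have [h2|h2] := leP `|E a b c d| (4 * `|E a m n d|).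
  by exists a, m, n, d; split=> //; split.
have [h3|h3] := leP `|E a b c d| (4 * `|E m b c n|).
  by exists m, b, c, n; split=> //; split.
exists m, b, n, d; split=> //; split=> //; lra.
Qed.

(** Bisection is iterated through a choice function. The inequalities between left and right ends at
    different stages are what yields a point common to all rectangles. *)
Lemma rect_integral_nest a b c d : a <= b -> b < s1 -> c <= d ->
  exists A B C D : nat -> R, forall n,
   [/\ B n - A n = (b - a) / 2 ^+ n, D n - C n = (d - c) / 2 ^+ n,
       `|E a b c d| <= 4 ^+ n * `|E (A n) (B n) (C n) (D n)|,
       (forall m, A m <= B n) /\ (forall m, C m <= D n) & B n <= b].
Proof.
move=> ab bs cd.
pose T := (R * R * R * R)%type.
pose ok (x : T) := [/\ x.1.1.1 <= x.1.1.2, x.1.1.2 < s1 & x.1.2 <= x.2].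
pose nxt (x y : T) := [/\ x.1.1.1 <= y.1.1.1, y.1.1.2 <= x.1.1.2, x.1.2 <= y.1.2, y.2 <= x.2 &
    [/\ y.1.1.2 - y.1.1.1 = (x.1.1.2 - x.1.1.1) / 2, y.2 - y.1.2 = (x.2 - x.1.2) / 2 &
        `|E x.1.1.1 x.1.1.2 x.1.2 x.2| <= 4 * `|E y.1.1.1 y.1.1.2 y.1.2 y.2|]].
have /choice[f fP] : forall x : T, exists y, ok x -> nxt x y.
  move=> [[[x1 x2] x3] x4]; have [[/= h1 h2 h3]|nok] := pselect (ok (x1, x2, x3, x4)); last by exists (0, 0, 0, 0).
  have [a' [b' [c' [d' h]]]] := rect_integral_bisect _ _ _ _ h1 h2 h3.
  by exists (a', b', c', d').
pose X n := iter n f (a, b, c, d).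
have okX n : ok (X n).
  elim: n => [|n IH]; first by split.
  have [/= h1 h2 h3 h4 [h5 h6 _]] := fP _ IH; have [h7 h8 h9] := IH.
  change (ok (f (X n))); split; last 2 first.
  - exact: le_lt_trans h2 h8.
  - by rewrite -subr_ge0 h6 divr_ge0 // subr_ge0.
  by rewrite -subr_ge0 h5 divr_ge0 // subr_ge0.
have nX n : nxt (X n) (X n.+1) by apply: fP.
pose A n := (X n).1.1.1; pose B n := (X n).1.1.2; pose C n := (X n).1.2; pose D n := (X n).2.
have incA : {homo A : m n / (m <= n)%N >-> m <= n}.
  by apply: homo_leq => [x|y x z|n]; [exact: lexx|exact: le_trans|case: (nX n)].
have incC : {homo C : m n / (m <= n)%N >-> m <= n}.
  by apply: homo_leq => [x|y x z|n]; [exact: lexx|exact: le_trans|case: (nX n)].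
have incB : {homo (fun k => - B k) : m n / (m <= n)%N >-> m <= n}.
  apply: homo_leq => [x|y x z|n]; [exact: lexx|exact: le_trans|rewrite lerN2; by case: (nX n)].
have incD : {homo (fun k => - D k) : m n / (m <= n)%N >-> m <= n}.
  apply: homo_leq => [x|y x z|n]; [exact: lexx|exact: le_trans|rewrite lerN2; by case: (nX n)].
have decB m n : (m <= n)%N -> B n <= B m by move=> /incB; rewrite lerN2.
have decD m n : (m <= n)%N -> D n <= D m by move=> /incD; rewrite lerN2.
exists A, B, C, D => n; split.
- elim: n => [|n IH]; first by rewrite expr0 divr1.
  by have [_ _ _ _ [-> _ _]] := nX n; rewrite exprSr invfM mulrA -IH.
- elim: n => [|n IH]; first by rewrite expr0 divr1.
  by have [_ _ _ _ [_ -> _]] := nX n; rewrite exprSr invfM mulrA -IH.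
- elim: n => [|n IH]; first by rewrite expr0 mul1r.
  apply: (le_trans IH); rewrite exprSr -mulrA ler_pM2l ?exprn_gt0 //.
  by case: (nX n) => _ _ _ _ [_ _].
- split=> m.
    apply: (le_trans (incA _ _ (leq_maxl m n))); apply: le_trans (decB _ _ (leq_maxr m n)).
    by case: (okX (maxn m n)).
  apply: (le_trans (incC _ _ (leq_maxl m n))); apply: le_trans (decD _ _ (leq_maxr m n)).
  by case: (okX (maxn m n)).
- exact: (decB 0 n).
Qed.

Lemma nested_segments (A B : nat -> R) : (forall m n, A m <= B n) ->
  exists x, forall n, A n <= x <= B n.
Proof.
move=> AB; exists (sup (range A)) => n; apply/andP; split.
  by apply: ub_le_sup; [exists (B 0) => _ [m _ <-]|exists n].
by apply: ge_sup; [exists (A 0); exists 0%N|move=> _ [m _ <-]].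
Qed.

(** With [w = W / 2 ^+ n], the expansion at the common point bounds the [n]-th integral by
    [2 e w^2]. The factor [4 ^+ n] lost in the bisections cancels the one in [w^2], so only a
    constant times [e] remains. *)
Lemma goursat a b c d : a <= b -> b < s1 -> c <= d -> E a b c d = 0.
Proof.
move=> ab bs cd; have [A [B [C [D ABCD]]]] := rect_integral_nest _ _ _ _ ab bs cd.
have [s sAB] : exists x, forall n, A n <= x <= B n.
  by apply: nested_segments => m n; case: (ABCD n) => _ _ _ [].
have [t tCD] : exists x, forall n, C n <= x <= D n.
  by apply: nested_segments => m n; case: (ABCD n) => _ _ _ [].
have ss : s < s1.
  by case: (ABCD 0%N) => _ _ _ _ B0; apply: le_lt_trans bs; apply: le_trans B0; case/andP: (sAB 0%N).
have [al [be h]] := uv_diff s t ss.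
pose W := (b - a) + (d - c).
have W0 : 0 <= W by rewrite /W; lra.
suff small e : 0 < e -> `|E a b c d| <= e * (4 * W ^+ 2).
  apply/eqP; rewrite -normr_le0; apply/ler_addgt0Pl => e e0; rewrite addr0.
  (* The summand 1 keeps the divisor positive for a rectangle reduced to a point. *)
  have W1 : 0 < 4 * W ^+ 2 + 1 by rewrite ltr_wpDl // mulr_ge0 // sqr_ge0.
  apply: le_trans (small (e / (4 * W ^+ 2 + 1)) _) _; first by rewrite divr_gt0.
  by rewrite -mulrA ger_pMr // ler_pdivrMl // mulr1 lerDl.
move=> e0; have [dl dl0 dP] := h e e0.
have [n nW] : exists n, W / 2 ^+ n < dl.
  have [n nP] : exists n : nat, W / dl < n%:R.
    exists (Num.trunc (W / dl)).+1; exact: truncnS_gt.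
  exists n; rewrite ltr_pdivrMr ?exprn_gt0 // mulrC -ltr_pdivrMr //.
  by apply: lt_trans nP _; rewrite -natrX ltr_nat ltn_expl.
have [BA DC En _ Bb] := ABCD n.
apply: (le_trans En).
set w := W / 2 ^+ n in nW.
have p2 : 0 < (2 : R) ^+ n by rewrite exprn_gt0.
have bw : (b - a) / 2 ^+ n <= w by rewrite ler_pM2r ?invr_gt0 // /W; lra.
have dw : (d - c) / 2 ^+ n <= w by rewrite ler_pM2r ?invr_gt0 // /W; lra.
have Ww : B n - A n + (D n - C n) = w by rewrite BA DC -mulrDl.
have /andP[As sB] := sAB n; have /andP[Ct tD] := tCD n.
have key x y : A n <= x <= B n -> C n <= y <= D n ->
    `|u x y - u s t - (al * (x - s) - be * (y - t))| <= e * w /\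
    `|v x y - v s t - (be * (x - s) + al * (y - t))| <= e * w.
  move=> /andP[x1 x2] /andP[y1 y2].
  have xw : `|x - s| <= B n - A n by rewrite ler_norml; lra.
  have yw : `|y - t| <= D n - C n by rewrite ler_norml; lra.
  have BAw : B n - A n <= w by rewrite BA.
  have DCw : D n - C n <= w by rewrite DC.
  have [h1 h2] := dP _ _ (le_lt_trans (le_trans xw BAw) nW) (le_lt_trans (le_trans yw DCw) nW).
  move: h1 h2.
  rewrite !(addrC s) !(addrC t) !subrK => h1 h2.
  have ew : e * (`|x - s| + `|y - t|) <= e * w by rewrite ler_pM2l // -Ww lerD.
  by split; [apply: le_trans h1 _|apply: le_trans h2 _].
(* For points on opposite edges, two expansions at [(s, t)] are subtracted, each with error at most
   [e * w]. *)
have := @rect_integral_near (A n) (B n) (C n) (D n) al (2 * (e * w)).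
have AB1 : A n <= B n := le_trans As sB.
have CD1 : C n <= D n := le_trans Ct tD.
have [kA kB kC kD] : [/\ A n <= A n <= B n, A n <= B n <= B n, C n <= C n <= D n & C n <= D n <= D n].
  by split; rewrite lexx ?AB1 ?CD1.
move=> /(_ AB1 (le_lt_trans Bb bs) CD1) near_.
have {}near_ : `|E (A n) (B n) (C n) (D n)| <= 2 * (e * w) * w.
  rewrite -{2}Ww; apply: near_ => [y yy|x xx].
    have [h1 _] := key _ _ kA yy; have [h2 _] := key _ _ kB yy.
    by move: h1 h2; rewrite !ler_norml; lra.
  have [_ h1] := key _ _ xx kC; have [_ h2] := key _ _ xx kD.
  by move: h1 h2; rewrite !ler_norml; lra.
have p4 : 0 < (4 : R) ^+ n by rewrite exprn_gt0.
apply: (@le_trans _ _ (4 ^+ n * (2 * (e * w) * w))); first by rewrite ler_pM2l.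
have -> : 4 ^+ n * (2 * (e * w) * w) = e * (2 * W ^+ 2).
  have -> : (4 : R) ^+ n = 2 ^+ n * 2 ^+ n by rewrite -exprMn; congr (_ ^+ _); lra.
  by rewrite /w; field; rewrite gt_eqF.
by rewrite ler_pM2l // ler_wpM2r ?sqr_ge0 //; lra.
Qed.
End Goursat.

(** * Circle means *)

Lemma is_derive_expansion (R : realType) (f : R -> R) (x a : R) : is_derive x 1 f a ->
  forall e, 0 < e -> exists2 d, 0 < d & forall h, `|h| < d -> `|f (x + h) - f x - a * h| <= e * `|h|.
Proof.
move=> [df <-] e e0.
have /cvgrPdist_le/(_ e e0) := df.
rewrite near_withinE => /nbhs_ballP[d /= d0 dP]; exists d => // h hd.
have [->|h0] := eqVneq h 0; first by rewrite addr0 mulr0 subrr subr0 normr0 mulr0.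
have := dP h; rewrite /ball /= sub0r normrN => /(_ hd h0).
have h0' : 0 < `|h| by rewrite normr_gt0.
rewrite -(ler_pM2r h0') -normrM; apply: le_trans.
rewrite -[X in X <= _]normrN le_eqVlt; apply/orP; left; apply/eqP; congr `|_|.
rewrite mulrBl [_ *: _]mulrC -mulrA mulVf // mulr1 [h *: 1]mulr1 (addrC h).
by rewrite (opprB _ ('D_1 f x * h)).
Qed.

Section Polar.
Variable R : realType.
Implicit Types (x y s t e : R) (z p : CC R).

(** This is [exp (s + i t)]: the segment [s = ln r], [0 <= t <= 2 pi] runs once around the circle of
    radius [r]. *)
Definition polar s t : CC R := ((expR s * cos t) +i* (expR s * sin t))%C.

Lemma polarD s t x y : polar (s + x) (t + y) = polar s t * polar x y.
Proof.
by apply/eqP; rewrite eq_complex; apply/andP; split; apply/eqP;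
  rewrite ?ReM ?ImM /= expRD ?cosD ?sinD; ring.
Qed.

Lemma polar2pi s : polar s (2 * pi) = polar s 0.
Proof. by rewrite /polar mulr_natl cos2pi sin2pi cos0 sin0. Qed.

Lemma cmod_polar s t : cmod (polar s t) = expR s.
Proof.
apply/eqP; rewrite -(@eqrXn2 _ 2) ?cmod_ge0 ?expR_ge0 //; apply/eqP.
by rewrite cmod_sqr /= !exprMn -mulrDr cos2Dsin2 mulr1.
Qed.

(** The complex exponential has derivative 1 at the origin, by the real expansions of [expR], [cos]
    and [sin]. The functional equation [polarD] transports this to every point. *)
Lemma polar_expansion e : 0 < e -> exists2 d, 0 < d & forall x y, `|x| < d -> `|y| < d ->
  cmod (polar x y - 1 - (x +i* y)%C) <= e * (`|x| + `|y|).
Proof.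
(* The real and the imaginary part each contribute at most k|x| + 2k|y|, whence the factor 4;
   [k <= 1 / 4] absorbs the factors [1 + x] and [1 + k]. *)
move=> e0; pose k := Num.min e 1 / 4.
have k0 : 0 < k by rewrite divr_gt0 // lt_min e0 ltr01.
have [ke k1] : 4 * k <= e /\ 4 * k <= 1.
  by rewrite /k mulrC divfK //; split; rewrite ge_min lexx ?orbT.
have [d1 d10 P1] := is_derive_expansion _ _ _ _ (is_derive_expR (0 : R)) k k0.
have [d2 d20 P2] := is_derive_expansion _ _ _ _ (is_derive_cos (0 : R)) k k0.
have [d3 d30 P3] := is_derive_expansion _ _ _ _ (is_derive_sin (0 : R)) k k0.
exists (Num.min (Num.min d1 d2) (Num.min d3 (k / 2))).
  by rewrite !lt_min d10 d20 d30 divr_gt0.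
move=> x y; rewrite !lt_min => /andP[/andP[x1 x2] /andP[x3 xk]] /andP[/andP[y1 y2] /andP[y3 yk]].
have := P1 x x1; rewrite add0r expR0 mul1r => ex.
have := P2 y y2; rewrite add0r cos0 sin0 oppr0 mul0r subr0 => cy.
have := P3 y y3; rewrite add0r cos0 sin0 mul1r subr0 => sy.
apply: le_trans (cmod_leRI _ _) _; rewrite !ReD !ImD !ReN !ImN /= oppr0 addr0.
set X := expR x in ex *; set c := cos y in cy *; set S := sin y in sy *.
have [xx yy] : `|x| * `|c| <= `|x| /\ `|c| <= 1.
  have c1 : `|c| <= 1 by rewrite ler_norml cos_geN1 cos_le1.
  by split=> //; rewrite ler_piMr.
have -> : X * c - 1 - x = (X - 1 - x) * c + (1 + x) * (c - 1).
  by ring.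
have -> : X * S - y = (X - 1 - x) * S + (x * S + (S - y)) by ring.
have S1 : `|S| <= 1 by rewrite ler_norml sin_geN1 sin_le1.
have S2 : `|S| <= `|y| * (1 + k).
  by have := ler_normD (S - y) y; rewrite subrK; move: sy; clear; lra.
have a1 : `|(X - 1 - x) * c| <= k * `|x|.
  by rewrite normrM -[leRHS]mulr1 ler_pM.
have a2 : `|(X - 1 - x) * S| <= k * `|x|.
  by rewrite normrM -[leRHS]mulr1 ler_pM.
have a3 : `|(1 + x) * (c - 1)| <= 2 * (k * `|y|).
  rewrite normrM ler_pM // (le_trans (ler_normD _ _)) // normr1; lra.
have a4 : `|x * S| <= k / 2 * (`|y| * (1 + k)).
  by rewrite normrM ler_pM // ltW.
have a5 : k / 2 * (`|y| * (1 + k)) <= k * `|y|.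
  rewrite -mulrA ler_pM2l // mulrC -mulrA ler_piMr //; lra.
apply: (@le_trans _ _ (4 * k * (`|x| + `|y|))); last by rewrite ler_wpM2r // addr_ge0.
have := ler_normD ((X - 1 - x) * c) ((1 + x) * (c - 1)).
have := ler_normD ((X - 1 - x) * S) (x * S + (S - y)).
have := ler_normD (x * S) (S - y).
have ? := normr_ge0 x; have ? := normr_ge0 y.
have kx : 0 <= k * `|x| by rewrite mulr_ge0 // ltW.
have ky : 0 <= k * `|y| by rewrite mulr_ge0 // ltW.
lra.
Qed.

(** Chain rule in the real form that Goursat's theorem expects: the derivative in the logarithmic
    coordinate is [al + i be = h'(z) * polar s t]. *)
Lemma polar_comp_expansion (h : CC R -> CC R) p (s t : R) : differentiable h (p + polar s t) ->
  exists al be : R, forall e, 0 < e ->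
  exists2 dl, 0 < dl & forall x y, `|x| < dl -> `|y| < dl ->
    `|complex.Re (h (p + polar (s + x) (t + y))) - complex.Re (h (p + polar s t)) - (al * x - be * y)| <= e * (`|x| + `|y|) /\
    `|complex.Im (h (p + polar (s + x) (t + y))) - complex.Im (h (p + polar s t)) - (be * x + al * y)| <= e * (`|x| + `|y|).
Proof.
set w := polar s t; set z := p + w => /differentiable_has_cderiv; set a := 'D_1 h z => ha.
exists (complex.Re (a * w)), (complex.Im (a * w)) => e e0.
pose K := cmod w + cmod (a * w) + 1.
have K0 : 0 < K by rewrite ltr_wpDl // addr_ge0 ?cmod_ge0.
have wK : cmod w <= K by rewrite /K -addrA lerDl addr_ge0 ?cmod_ge0.
have awK : cmod (a * w) <= K by rewrite /K -addrA addrCA lerDl addr_ge0 ?cmod_ge0.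
pose k := Num.min 1 (e / (3 * K)).
have k0 : 0 < k by rewrite lt_min ltr01 divr_gt0 // mulr_gt0.
have k1 : k <= 1 by rewrite ge_min lexx.
have ke : 3 * (k * K) <= e.
  by rewrite mulrCA -ler_pdivlMr ?mulr_gt0 // ge_min lexx orbT.
have [d1 d10 P1] := ha k k0; have [d2 d20 P2] := polar_expansion k k0.
exists (Num.min d2 (d1 / (4 * K))); first by rewrite lt_min d20 divr_gt0 // mulr_gt0.
move=> x y; rewrite !lt_min => /andP[x2 x1] /andP[y2 y1].
set N := `|x| + `|y|.
set zt : CC R := (x +i* y)%C.
pose r : CC R := polar x y - 1 - zt.
have rN : cmod r <= k * N by apply: P2.
have N0 : 0 <= N by rewrite addr_ge0.
have ztN : cmod zt <= N by exact: cmod_leRI.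
pose q : CC R := w * (zt + r).
have qE : p + polar (s + x) (t + y) = z + q.
  by rewrite /q /r polarD -/w /z; ring.
have zr2 : cmod (zt + r) <= 2 * N.
  apply: le_trans (cmodD _ _ _) _.
  have : k * N <= N by rewrite ler_piMl.
  lra.
have qN : cmod q <= 2 * K * N.
  by rewrite cmodM (_ : 2 * K * N = K * (2 * N)) ?ler_pM ?cmod_ge0 //; ring.
have qd : cmod q < d1.
  apply: le_lt_trans qN _; rewrite -ltr_pdivlMl ?mulr_gt0 //.
  move: x1 y1; rewrite !ltr_pdivlMr ?mulr_gt0 // => x1 y1.
  rewrite ltr_pdivlMl ?mulr_gt0 //.
  have -> : 2 * K * N = (`|x| * (4 * K) + `|y| * (4 * K)) / 2 by rewrite /N; field.
  lra.
have main : cmod (h (z + q) - h z - a * w * zt) <= e * N.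
  have -> : h (z + q) - h z - a * w * zt = (h (z + q) - h z - a * q) + a * w * r.
    by rewrite /q; ring.
  apply: le_trans (cmodD _ _ _) _; apply: (@le_trans _ _ (k * (2 * K * N) + K * (k * N))).
    apply: lerD; first by apply: le_trans (P1 _ qd) _; rewrite ler_pM2l.
    by rewrite cmodM ler_pM ?cmod_ge0.
  have -> : k * (2 * K * N) + K * (k * N) = 3 * (k * K) * N by ring.
  by rewrite ler_wpM2r.
rewrite qE; split.
  apply: le_trans main; apply: le_trans (normRe_le _ _).
  by rewrite !ReD !ReN (ReM _ (a * w) zt).
apply: le_trans main; apply: le_trans (normIm_le _ _).
by rewrite !ImD !ImN (ImM _ (a * w) zt) [in leRHS](addrC (_ * _)).
Qed.

Lemma circle_Re_le (h : CC R -> CC R) p (r r' B : R) : 0 < r -> r < r' ->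
  {for p, continuous h} -> (forall z, 0 < cmod (z - p) -> cmod (z - p) < r' -> differentiable h z) ->
  (forall z, cmod (z - p) = r -> complex.Re (h z) <= B) -> complex.Re (h p) <= B.
Proof.
move=> r0 rr' hp hd hB; apply/ler_addgt0Pr => e e0.
have [dl dl0 dP] := (continuous_cmodP _ _ _).1 hp e e0.
have r'0 := lt_trans r0 rr'.
pose u s t := complex.Re (h (p + polar s t)); pose v s t := complex.Im (h (p + polar s t)).
have pE s t : cmod (p + polar s t - p) = expR s by rewrite addrC addKr cmod_polar.
have hds s t : s < ln r' -> differentiable h (p + polar s t).
  by move=> ss; apply: hd; rewrite pE ?expR_gt0 // -[ltRHS]lnK ?posrE // ltr_expR.
have uv s t (ss : s < ln r') := polar_comp_expansion h p s t (hds s t ss).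
have [b bE] : exists b, b = ln r by exists (ln r).
(* The inner radius [expR a] is below [dl], so that on the inner circle [h] differs from [h p] by
   less than [e]; the minimum with [b] keeps the rectangle oriented. *)
have [a aE] : exists a, a = Num.min b (ln (dl / 2)) by exists (Num.min b (ln (dl / 2))).
have ab : a <= b by rewrite aE ge_min lexx.
have adl : expR a < dl.
  have dl2 : dl / 2 < dl by rewrite ltr_pdivrMr // ltr_pMr // ltr1n.
  have E : expR (ln (dl / 2)) = dl / 2 by apply: lnK; rewrite posrE divr_gt0.
  by apply: le_lt_trans dl2; rewrite -E ler_expR aE ge_min lexx orbT.
have bs : b < ln r' by rewrite bE ltr_ln ?posrE.
have pi20 : 0 < 2 * pi :> R by rewrite mulr_gt0 // pi_gt0.
have := goursat R (ln r') u v uv a b 0 (2 * pi) ab bs (ltW pi20).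
(* Periodicity cancels the horizontal edges. What remains says that [u] has the same integral over
   both circles. *)
rewrite /rect_integral; have -> : v^~ (2 * pi) = v^~ 0 by apply/funext => s; rewrite /v polar2pi.
rewrite [X in _ - X]subrr subr0 => /subr0_eq Iab.
have cu s : s < ln r' -> seg_continuous _ (u s) 0 (2 * pi).
  by move=> ss t _; exact: (cauchy_riemann_continuous R (ln r') u v uv).
clear uv hds.
have h1 : seg_integral _ (u b) 0 (2 * pi) <= B * (2 * pi - 0).
  apply: seg_integral_le; [exact: ltW|exact: cu|move=> t _].
  by apply: hB; rewrite pE bE lnK ?posrE.
have h2 : (complex.Re (h p) - e) * (2 * pi - 0) <= seg_integral _ (u a) 0 (2 * pi).
  apply: seg_integral_ge; [exact: ltW|exact: cu (le_lt_trans ab bs)|move=> t _].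
  have : cmod (h (p + polar a t) - h p) < e.
    by apply: dP; rewrite (pE a t).
  move=> /(le_lt_trans (normRe_le _ _)); rewrite ReD ReN ltr_norml /u.
  by move: (complex.Re (h (p + polar a t))) => X; clear; lra.
by move: h2; rewrite -Iab => /le_trans /(_ h1); rewrite ler_pM2r ?subr0 // lerBlDr.
Qed.
End Polar.

(** * The maximum modulus principle *)

Lemma near_eq_differentiable (K : numFieldType) (V W : normedModType K) (f g : V -> W) (x : V) :
  (\forall y \near x, f y = g y) -> differentiable g x -> differentiable f x.
Proof.
move=> fg dg; have dgc := diff_continuous dg.
have fgx : f x = g x by exact: nbhs_singleton fg.
have sx : (h + x) @[h --> (0 : V)] --> x.
  by rewrite -[X in _ --> X]add0r; apply: cvgD; [exact: cvg_id|exact: cvg_cst].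
have H : f \o shift x = cst (f x) + 'd g x +o_ (nbhs (0 : V)) id.
  apply/eqaddoP => e e0; have /eqaddoP/(_ e e0) := diff_locally dg.
  have := sx _ fg; rewrite /= => fg0 gd; near=> h.
  have -> : (f \o shift x - (cst (f x) + 'd g x)) h = (g \o shift x - (cst (g x) + 'd g x)) h.
    by rewrite !fctE /= fgx; congr (_ - _); near: h.
  by near: h.
by apply/diff_locallyP; split; rewrite (diff_unique dgc H).
Unshelve. all: by end_near.
Qed.

Section MaximumModulus.
Variable R : realType.
Implicit Types (f k : CC R -> CC R) (z w p c : CC R) (r M B : R) (S : seq (CC R)).

Lemma cmod_continuous : continuous (@cmod R : CC R -> R).
Proof.
move=> z P /nbhs_ballP[e /= e0 eP]; apply/nbhs_cmodP; exists e => // w wz; apply: eP.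
have := cmod_dist _ z w; have := cmod_dist _ w z; rewrite (cmodB _ z w) /ball /= ltr_norml.
by move: wz; clear; lra.
Qed.

Lemma continuous_translation p : continuous (fun z : CC R => z - p).
Proof.
move=> z P /nbhs_cmodP[e e0 eP]; apply/nbhs_cmodP; exists e => // w wz; apply: eP.
by rewrite opprB addrA subrK.
Qed.

Lemma closed_disc_compact p r : compact [set z : CC R | cmod (z - p) <= r].
Proof.
pose g (x : R * R) : CC R := p + (x.1 +i* x.2)%C.
have gc : continuous g.
  move=> [x y] P /nbhs_cmodP[e e0 eP].
  exists (ball x (e / 2), ball y (e / 2)) => /=.
    by split; apply: nbhsx_ballx; rewrite divr_gt0.
  move=> [x' y'] [/= hx hy]; apply: eP; rewrite /g /= opprD addrACA subrr add0r.
  apply: le_lt_trans (cmod_leRI _ _) _; rewrite ReD ImD ReN ImN /=.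
  by move: hx hy; rewrite /ball /= distrC => hx; rewrite distrC => hy; lra.
have Kc : compact (g @` (`[- r, r] `*` `[- r, r])).
  apply: continuous_compact; first exact: continuous_subspaceT.
  have sc : compact (`[- r, r] : set R) by exact: segment_compact.
  exact: (compact_setX sc sc).
apply: (subclosed_compact _ Kc).
  have -> : [set z : CC R | cmod (z - p) <= r] = (fun z => cmod (z - p)) @^-1` [set x | x <= r] by [].
  apply: preimage_closed; last exact: closed_le.
  move=> z _; apply: (@continuous_comp _ _ R (fun z => z - p)); last exact: cmod_continuous.
  exact: continuous_translation.
move=> z /= zr; exists (complex.Re (z - p), complex.Im (z - p)).
  have h1 := le_trans (normRe_le _ (z - p)) zr; have h2 := le_trans (normIm_le _ (z - p)) zr.
  by move: h1 h2; rewrite !ler_norml /= !in_itv /=.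
rewrite /g /=; set w := z - p; have -> : (complex.Re w +i* complex.Im w)%C = w by case: w.
by rewrite /w addrC subrK.
Qed.

Lemma seq_isolated S c : exists2 d : R, 0 < d & forall z, 0 < cmod (z - c) -> cmod (z - c) < d -> z \notin S.
Proof.
elim: S => [|a S [d d0 dP]]; first by exists 1.
have [->|ac] := eqVneq a c.
  exists d => // z z0 zd; rewrite inE negb_or dP // andbT; apply/eqP => zc.
  by move: z0; rewrite zc subrr cmod0 ltxx.
exists (Num.min d (cmod (a - c))); first by rewrite lt_min d0 cmod_gt0 subr_eq0.
move=> z z0; rewrite lt_min => /andP[zd za]; rewrite inE negb_or dP // andbT.
by apply/eqP => zE; move: za; rewrite zE ltxx.
Qed.

Lemma unit_rotation (a : CC R) : exists2 g : CC R, cmod g = 1 & complex.Re (g * a) = cmod a.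
Proof.
have [->|a0] := eqVneq a 0; first by exists 1; [exact: cmod1|rewrite mulr0 cmod0].
exists ((cmod a)%:C%C / a).
  by rewrite cmodM cmodV cmodR ger0_norm ?cmod_ge0 // divff // cmod_eq0.
by rewrite divfK.
Qed.

(** If [cmod (f z) > B], the perturbed modulus [phi] attains its maximum at an interior point [c],
    and there [circle_Re_le] is violated by a function [h] holomorphic near [c]. Only continuity is
    required at the centre of the circle, so [c] may itself belong to [S]. *)
Lemma max_modulus f p r S B : 0 < r ->
  (forall z, cmod (z - p) <= r -> {for z, continuous f}) ->
  (forall z, cmod (z - p) < r -> z \notin S -> differentiable f z) ->
  (forall z, cmod (z - p) = r -> cmod (f z) <= B) ->
  forall z, cmod (z - p) <= r -> cmod (f z) <= B.
Proof.
move=> r0 fc fd fB z zr; rewrite leNgt; apply/negP => Bz.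
(* On the boundary the perturbation is half the excess of [cmod (f z)] over [B], too little to bring
   the maximum there. *)
pose e := (cmod (f z) - B) / (2 * r ^+ 2).
have r20 : 0 < r ^+ 2 by rewrite exprn_gt0.
have e0 : 0 < e by rewrite divr_gt0 ?subr_gt0 ?mulr_gt0.
have er : e * r ^+ 2 = (cmod (f z) - B) / 2 by rewrite /e; field; rewrite gt_eqF.
pose D := [set z : CC R | cmod (z - p) <= r].
pose phi w : R := cmod (f w) + e * cmod (w - p) ^+ 2.
have phic : {within D, continuous phi}.
  apply: continuous_in_subspaceT => w; rewrite inE => wD.
  have cwp : {for w, continuous (@cmod R \o (fun w => w - p))}.
    by apply: continuous_comp; [exact: continuous_translation|exact: cmod_continuous].
  have cf : {for w, continuous (@cmod R \o f)}.
    by apply: continuous_comp; [exact: fc|exact: cmod_continuous].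
  exact: (cvgD cf (cvgM (cvg_cst e) (cvgM cwp cwp))).
have [|c cD cmax] := compact_EVT_max _ (closed_disc_compact p r) phic.
  by exists z.
have {cD}cr : cmod (c - p) <= r by move: cD; rewrite inE.
have {}cmax w : cmod (w - p) <= r -> phi w <= phi c by move=> wr; apply: cmax; rewrite inE.
have zc : cmod (f z) <= phi c.
  by apply: le_trans (cmax _ zr); rewrite lerDl mulr_ge0 ?sqr_ge0 // ltW.
have {cr}cr : cmod (c - p) < r.
  rewrite lt_neqAle cr andbT; apply/eqP => cE.
  by move: zc; rewrite /phi cE er; have := fB _ cE; lra.
have [g g1 gfc] := unit_rotation (f c).
have [d d0 dS] := seq_isolated S c.
pose A := c - p.
(* The linear term has as real part [e] times the cross term of [cmod (w - p) ^+ 2] expanded about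
   [c]. Hence [complex.Re (h w)] is at most [phi w] minus [e * cmod A ^+ 2] and
   [e * cmod (w - c) ^+ 2]; the last summand gives a strict drop on the circle. *)
pose h w := g * f w + (2 * e)%:C%C * (A^*)%C * (w - c).
pose r' := Num.min d (r - cmod (c - p)).
have r'0 : 0 < r' by rewrite lt_min d0 subr_gt0.
have inr w : cmod (w - c) < r' -> cmod (w - p) < r.
  rewrite lt_min => /andP[_ wr]; have := cmodD _ (w - c) (c - p).
  by rewrite addrA subrK => /le_lt_trans; apply; rewrite -ltrBrDr.
have hc : h c = g * f c by rewrite /h subrr mulr0 addr0.
suff : complex.Re (h c) <= cmod (f c) - e * (r' / 2) ^+ 2.
  have : 0 < e * (r' / 2) ^+ 2 by rewrite mulr_gt0 // exprn_gt0 // divr_gt0.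
  by rewrite hc gfc; clear; lra.
apply: (@circle_Re_le R h c (r' / 2) r').
- by rewrite divr_gt0.
- by rewrite ltr_pdivrMr // ltr_pMr // ltr1n.
- exact: (cvgD (cvgM (cvg_cst g) (fc c (ltW cr))) (cvgM (cvg_cst _) (continuous_translation c c))).
- move=> w w0 wr; apply: (@differentiableD _ _ (CC R)).
    apply: (@differentiableM R[i]); first exact: differentiable_cst.
    by apply: fd; [exact: inr|apply: dS => //; move: wr; rewrite lt_min => /andP[]].
  apply: (@differentiableM R[i]); first exact: differentiable_cst.
  by apply: (@differentiableB _ _ (CC R)); [exact: ex_diff|exact: differentiable_cst].
move=> w wc.
have wp : cmod (w - p) <= r.
  by apply/ltW/inr; rewrite wc ltr_pdivrMr // ltr_pMr // ltr1n.
have h1 : complex.Re (g * f w) <= cmod (f w).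
  by apply: le_trans (ler_norm _) _; apply: le_trans (normRe_le _ _) _; rewrite cmodM g1 mul1r.
have h2 : cmod (w - p) ^+ 2 = cmod A ^+ 2 + cmod (w - c) ^+ 2 + 2 * complex.Re ((A^*)%C * (w - c)).
  have -> : w - p = A + (w - c) by rewrite /A; ring.
  rewrite !cmod_sqr ReM ReD ImD; case: (A) => a b /=; ring.
have h3 : complex.Re ((2 * e)%:C%C * (A^*)%C * (w - c)) = e * (2 * complex.Re ((A^*)%C * (w - c))).
  by rewrite -mulrA ReM /= mul0r subr0; ring.
have := cmax w wp; rewrite /phi h2 wc ReD h3 -/A.
set X := complex.Re ((A^*)%C * (w - c)); set Y := complex.Re (g * f w) in h1 *.
move: h1; clear; lra.
Qed.
End MaximumModulus.

(** * Difference quotients and removable singularities *)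

Lemma near_eq_continuous (T U : topologicalType) (f g : T -> U) (x : T) :
  (\forall y \near x, f y = g y) -> {for x, continuous g} -> {for x, continuous f}.
Proof.
move=> fg gc P; rewrite (nbhs_singleton fg) => /gc.
by apply: filterS2 fg => y fgy; rewrite /= fgy.
Qed.

Section DifferenceQuotient.
Variable R : realType.
Implicit Types (f k : CC R -> CC R) (x y z w p : CC R) (r M B : R) (S : seq (CC R)).

(** The intervals with centre [s x] and radius [wt x] meet pairwise, so the supremum of their left
    ends lies in all of them. *)
Lemma midpoint_bound (T : Type) (D : set T) (s wt : T -> R) : D !=set0 ->
  (forall x y : T, D x -> D y -> `|s x - s y| <= wt x + wt y) ->
  exists a, forall x : T, D x -> `|s x - a| <= wt x.
Proof.
move=> [x0 Dx0] hs.
have ub (y : T) : D y -> ubound [set s x - wt x | x in D] (s y + wt y).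
  by move=> Dy _ [x Dx <-]; have := hs _ _ Dx Dy; rewrite ler_norml; lra.
have ne : [set s x - wt x | x in D] !=set0 by exists (s x0 - wt x0), x0.
exists (sup [set s x - wt x | x in D]) => x Dx.
have h1 : sup [set s x - wt x | x in D] <= s x + wt x by apply: ge_sup => //; exact: ub.
have h2 : s x - wt x <= sup [set s x - wt x | x in D].
  by apply: ub_le_sup; [exists (s x + wt x); exact: ub|exists x].
rewrite ler_norml; lra.
Qed.

(* Replaces completeness: when [wt] tends to 0, [a] is the limit of [s]. *)
Lemma cauchy_bound (T : Type) (D : set T) (s : T -> CC R) (wt : T -> R) : D !=set0 ->
  (forall x y : T, D x -> D y -> cmod (s x - s y) <= wt x + wt y) ->
  exists a, forall x : T, D x -> cmod (s x - a) <= 2 * wt x.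
Proof.
move=> D0 hs.
have [a aP] : exists a, forall x : T, D x -> `|complex.Re (s x) - a| <= wt x.
  apply: midpoint_bound => // x y Dx Dy; apply: le_trans (hs _ _ Dx Dy).
  by rewrite -ReN -ReD normRe_le.
have [b bP] : exists a, forall x : T, D x -> `|complex.Im (s x) - a| <= wt x.
  apply: midpoint_bound => // x y Dx Dy; apply: le_trans (hs _ _ Dx Dy).
  by rewrite -ImN -ImD normIm_le.
exists (a +i* b)%C => x Dx; apply: le_trans (cmod_leRI _ _) _.
rewrite ReD ImD ReN ImN /=; have := aP _ Dx; have := bP _ Dx; lra.
Qed.

Definition dq k x0 x : CC R := if x == x0 then 'D_1 k x0 else (k x - k x0) / (x - x0).

Lemma dqE k x0 x : x != x0 -> dq k x0 x = (k x - k x0) / (x - x0).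
Proof. by rewrite /dq => /negPf ->. Qed.

Lemma dqK k x0 x : (x - x0) * dq k x0 x = k x - k x0.
Proof.
have [->|xx0] := eqVneq x x0; first by rewrite !subrr mul0r.
by rewrite dqE // mulrC divfK // subr_eq0.
Qed.

Lemma near_neq x x0 : x != x0 -> \forall y \near x, y != x0.
Proof.
move=> xx0; apply/nbhs_cmodP; exists (cmod (x - x0)); first by rewrite cmod_gt0 subr_eq0.
by move=> y; apply: contraTneq => ->; rewrite cmodB ltxx.
Qed.

Lemma quotient_differentiable k x0 x : x != x0 -> differentiable k x ->
  differentiable (fun y => (k y - k x0) / (y - x0)) x.
Proof.
move=> xx0 dk; apply: (@differentiableM R[i]).
  by apply: (@differentiableB _ _ (CC R)); [exact: dk|exact: differentiable_cst].
apply: (@differentiableV R[i]); last by rewrite subr_eq0.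
by apply: (@differentiableB _ _ (CC R)); [exact: ex_diff|exact: differentiable_cst].
Qed.

Lemma dq_differentiable k x0 x : x != x0 -> differentiable k x -> differentiable (dq k x0) x.
Proof.
move=> xx0 dk; apply: near_eq_differentiable (quotient_differentiable k x0 x xx0 dk).
by apply: filterS (near_neq _ _ xx0) => y; exact: dqE.
Qed.

Lemma dq_continuous_off k x0 x : x != x0 -> {for x, continuous k} ->
  {for x, continuous (dq k x0)}.
Proof.
move=> xx0 ck.
have qc : {for x, continuous (fun y => (k y - k x0) / (y - x0))}.
  apply: (cvgM (cvgB ck (cvg_cst _))); apply: cvgV; first by rewrite subr_eq0.
  exact: continuous_translation.
apply: near_eq_continuous qc.
by apply: filterS (near_neq _ _ xx0) => y yx; rewrite dqE.
Qed.

Lemma dq_continuous_at k x0 : differentiable k x0 -> {for x0, continuous (dq k x0)}.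
Proof.
move=> /differentiable_has_cderiv kd; apply/continuous_cmodP => e e0.
have [d d0 dP] := kd (e / 2) (divr_gt0 e0 (ltr0n _ 2)).
exists d => // x xd; have [->|xx0] := eqVneq x x0; first by rewrite subrr cmod0.
have xx0' : 0 < cmod (x - x0) by rewrite cmod_gt0 subr_eq0.
rewrite dqE // /dq eqxx.
have := dP _ xd; rewrite (addrC x0) subrK.
have -> : k x - k x0 - 'D_1 k x0 * (x - x0) = ((k x - k x0) / (x - x0) - 'D_1 k x0) * (x - x0).
  by rewrite mulrBl divfK // subr_eq0.
rewrite cmodM ler_pM2r // => /le_lt_trans; apply; lra.
Qed.

(** The hypotheses of [max_modulus] together with a bound on the whole closed disc, in a form that
    passes from a function to its difference quotients. *)
Definition disc_class p r S M k :=
  [/\ 0 < r, forall z, cmod (z - p) <= r -> {for z, continuous k},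
      forall z, cmod (z - p) < r -> z \notin S -> differentiable k z &
      forall z, cmod (z - p) <= r -> cmod (k z) <= M].

(** On the boundary circle the numerator is at most [2 M] and the denominator at least [r / 2];
    [max_modulus] carries the bound inside. At [x0] the quotient is only known to be continuous, so
    [x0] joins the exceptional points. *)
Lemma dq_class p r S M k x0 : disc_class p r S M k -> cmod (x0 - p) <= r / 2 -> x0 \notin S ->
  disc_class p r (x0 :: S) (4 * M / r) (dq k x0).
Proof.
move=> [r0 kc kd kM] x0r x0S.
have x0r1 : cmod (x0 - p) <= r by apply: le_trans x0r _; lra.
have x0r2 : cmod (x0 - p) < r by apply: le_lt_trans x0r _; lra.
have dx0 := kd _ x0r2 x0S.
have c z : cmod (z - p) <= r -> {for z, continuous (dq k x0)}.
  move=> zr; have [->|zx] := eqVneq z x0; first exact: dq_continuous_at.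
  exact: dq_continuous_off zx (kc _ zr).
have d z : cmod (z - p) < r -> z \notin x0 :: S -> differentiable (dq k x0) z.
  by rewrite inE negb_or => zr /andP[zx zS]; apply: dq_differentiable zx (kd _ zr zS).
split=> //; apply: (max_modulus _ _ _ _ _ _ r0 c d) => z zr.
have zx : r / 2 <= cmod (z - x0).
  have := cmodD _ (z - x0) (x0 - p); rewrite addrA subrK zr; lra.
have zx0 : 0 < cmod (z - x0) by apply: lt_le_trans zx; rewrite divr_gt0.
have zx1 : z != x0 by rewrite -subr_eq0 -cmod_gt0.
rewrite dqE // cmodM cmodV ler_pdivrMr //.
have zM := kM z; rewrite zr lexx in zM.
have xM := kM _ x0r1.
have := cmodD _ (k z) (- k x0); rewrite cmodN => /le_trans; apply.
have M0 : 0 <= M := le_trans (cmod_ge0 _ _) xM.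
have h : 4 * M / r * (r / 2) <= 4 * M / r * cmod (z - x0).
  by rewrite ler_wpM2l // divr_ge0 ?(ltW r0) // mulr_ge0.
apply: le_trans h; have -> : 4 * M / r * (r / 2) = M + M by field; rewrite gt_eqF.
by apply: lerD => //; exact: zM.
Qed.

Lemma disc_class_lipschitz p r S M k x0 x : disc_class p r S M k -> cmod (x0 - p) <= r / 2 ->
  x0 \notin S -> cmod (x - p) <= r -> cmod (k x - k x0) <= 4 * M / r * cmod (x - x0).
Proof.
move=> kS x0r x0S xr; have [_ _ _ h] := dq_class _ _ _ _ _ _ kS x0r x0S.
by rewrite -dqK cmodM mulrC ler_wpM2r ?cmod_ge0 // h.
Qed.

Lemma closure_bound (f g : CC R -> CC R) (c : R) x :
  {for x, continuous f} -> {for x, continuous g} ->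
  (\forall y \near x, y != x -> cmod (f y - g y) <= c) -> cmod (f x - g x) <= c.
Proof.
move=> /continuous_cmodP fc /continuous_cmodP gc /nbhs_cmodP[d d0 dP].
apply/ler_addgt0Pr => e e0; have e2 : 0 < e / 2 by rewrite divr_gt0.
have [d1 d10 P1] := fc _ e2; have [d2 d20 P2] := gc _ e2.
pose m := Num.min d (Num.min d1 d2) / 2.
have m0 : 0 < m by rewrite divr_gt0 // !lt_min d0 d10.
pose y : CC R := x + (m%:C)%C.
have yx : cmod (y - x) = m by rewrite /y addrC addKr cmodR gtr0_norm.
have [md md1 md2] : [/\ m < d, m < d1 & m < d2].
  have h : m < Num.min d (Num.min d1 d2) by rewrite /m in m0 *; lra.
  by move: h; rewrite !lt_min => /andP[? /andP[? ?]].
have y0 : y != x by rewrite -subr_eq0 -cmod_gt0 yx.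
have a := dP y; rewrite yx in a; have {}a := a md y0.
have b1 := P1 y; rewrite yx in b1; have {}b1 := b1 md1.
have b2 := P2 y; rewrite yx in b2; have {}b2 := b2 md2.
have -> : f x - g x = (f y - g y) - (f y - f x) + (g y - g x) by ring.
apply: le_trans (cmodD _ _ _) _; have := cmodD _ (f y - g y) (- (f y - f x)).
rewrite cmodN; move: a b1 b2; clear; lra.
Qed.

(** For [x] near [p] but different from it, [dq k x] is Lipschitz with a constant [C] independent of
    [x]. Letting [x] tend to [p] makes the quotients centred at [p] Lipschitz as well, so they have
    a limit at [p], which is the derivative. *)
Lemma removable_singularity k p r : 0 < r ->
  (forall z, cmod (z - p) < r -> {for z, continuous k}) ->
  (forall z, cmod (z - p) < r -> z != p -> differentiable k z) ->
  differentiable k p.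
Proof.
move=> r0 kc kd.
have p0 : cmod (p - p) = 0 by rewrite subrr cmod0.
have kp : {for p, continuous k} by apply: kc; rewrite p0.
have [d d0 dP] : exists2 d, 0 < d & forall z, cmod (z - p) < d -> cmod (k z - k p) < 1.
  exact: (continuous_cmodP _ _ _).1 kp 1 ltr01.
pose rho := Num.min d r / 2; pose M := cmod (k p) + 1.
have rho0 : 0 < rho by rewrite divr_gt0 // lt_min d0.
have [rd rr] : rho < d /\ rho < r.
  have h : rho < Num.min d r by rewrite /rho in rho0 *; lra.
  by move: h; rewrite lt_min => /andP[].
have kM : disc_class p rho [:: p] M k.
  split; [exact: rho0|move=> z zr|move=> z zr|move=> z zr].
  - exact: kc (le_lt_trans zr rr).
  - by rewrite mem_seq1; apply: kd; apply: lt_trans rr.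
  have := cmod_dist _ (k p) (k z); have := dP z (le_lt_trans zr rd); rewrite /M; clear; lra.
pose M1 := 4 * M / rho; pose C := 4 * M1 / rho.
pose s t := (k t - k p) / (t - p).
have key y z : cmod (y - p) <= rho / 2 -> cmod (z - p) <= rho / 2 -> y != p -> z != p -> 
    cmod (s y - s z) <= C * cmod (y - z).
  move=> yr zr yp zp.
  have [->|yz] := eqVneq y z; first by rewrite !subrr cmod0 mulr0.
  pose f x := (k y - k x) / (y - x); pose g x := (k z - k x) / (z - x).
  have qc y' : y' != p -> {for p, continuous (fun x => (k y' - k x) / (y' - x))}.
    move=> y'p; apply: (cvgM (cvgB (cvg_cst _) kp)); apply: cvgV; first by rewrite subr_eq0.
    exact: (cvgB (cvg_cst _) cvg_id).
  apply: (closure_bound f g) (qc _ yp) (qc _ zp) _.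
  have nr : \forall x \near p, cmod (x - p) <= rho / 2.
    by apply/nbhs_cmodP; exists (rho / 2); [rewrite divr_gt0|move=> x /ltW].
  have ny : \forall x \near p, x != y by apply: near_neq; rewrite eq_sym.
  have nz : \forall x \near p, x != z by apply: near_neq; rewrite eq_sym.
  apply: filterS3 nr ny nz => x xr xy xz xp.
  have cx : disc_class p rho [:: x; p] M1 (dq k x) by apply: dq_class kM xr _; rewrite inE.
  have := disc_class_lipschitz _ _ _ _ _ z y cx zr.
  rewrite !inE negb_or eq_sym xz zp => /(_ isT); rewrite /f /g -!dqE 1?eq_sym //.
  by apply; apply: le_trans yr _; rewrite ler_pdivrMr // ler_pMr // ler1n.
have C0 : 0 <= C.
  rewrite divr_ge0 ?(ltW rho0) // mulr_ge0 // divr_ge0 ?(ltW rho0) // mulr_ge0 //.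
  by rewrite addr_ge0 ?cmod_ge0.
have [a aP] : exists a, forall t, cmod (t - p) <= rho / 2 /\ t != p -> cmod (s t - a) <= 2 * (C * cmod (t - p)).
  apply: (cauchy_bound _ [set t | cmod (t - p) <= rho / 2 /\ t != p] s (fun t => C * cmod (t - p))).
    pose y : CC R := p + ((rho / 2)%:C)%C.
    have yp : cmod (y - p) = rho / 2 by rewrite /y addrC addKr cmodR gtr0_norm // divr_gt0.
    by exists y; split; rewrite /= ?yp // -subr_eq0 -cmod_gt0 yp divr_gt0.
  move=> y z [yr yp] [zr zp]; apply: le_trans (key _ _ yr zr yp zp) _.
  rewrite -mulrDr ler_wpM2l // (cmodB _ z p).
  by have := cmodD _ (y - p) (p - z); rewrite addrA subrK.
have C1 : 0 < 2 * C + 1 by move: C0; clear; lra.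
apply: (has_cderiv_differentiable _ _ _ a) => e e0.
exists (Num.min (rho / 2) (e / (2 * C + 1))).
  by rewrite lt_min (divr_gt0 rho0) // (divr_gt0 e0 C1).
move=> h; rewrite lt_min => /andP[hr he].
have [->|h0] := eqVneq h 0; first by rewrite addr0 subrr mulr0 subr0 cmod0 mulr0.
have := aP (p + h); have hE : p + h - p = h by rewrite addrC addKr.
rewrite /s hE => /(_ (conj (ltW hr) _)).
rewrite -subr_eq0 hE => /(_ h0) hh.
have -> : k (p + h) - k p - a * h = ((k (p + h) - k p) / h - a) * h by rewrite mulrBl divfK.
rewrite cmodM ler_wpM2r ?cmod_ge0 //; apply: le_trans hh _.
move: he; rewrite ltr_pdivlMr // => he.
have := cmod_ge0 _ h; move: he; clear; lra.
Qed.
End DifferenceQuotient.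

(** * Osgood's lemma *)

Section Division.
Variable R : realType.
Implicit Types (f k : CC R -> CC R) (x y z w t a b c p : CC R) (r M B e : R).
Implicit Types (F G : CC R * CC R -> CC R) (u : CC R * CC R).

Lemma disc_class_removable p r S M k : disc_class R p r S M k -> disc_class R p r [::] M k.
Proof.
move=> [r0 kc kd kM]; split; [exact: r0|exact: kc| |exact: kM] => z zr _.
have [d d0 dP] := seq_isolated _ S z.
have rz : 0 < r - cmod (z - p) by rewrite subr_gt0.
have inr w : cmod (w - z) < Num.min d (r - cmod (z - p)) -> cmod (w - p) < r.
  rewrite lt_min => /andP[_ wr]; have := cmodD _ (w - z) (z - p).
  by rewrite addrA subrK => /le_lt_trans; apply; rewrite -ltrBrDr.
apply: (removable_singularity _ k z (Num.min d (r - cmod (z - p)))).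
- by rewrite lt_min d0.
- by move=> w /inr /ltW; exact: kc.
move=> w wz wz0; apply: kd (inr _ wz) (dP _ _ _); first by rewrite cmod_gt0 subr_eq0.
by move: wz; rewrite lt_min => /andP[].
Qed.

(* For each fixed second variable, the difference quotient in the first
   variable is Lipschitz uniformly in the second, and conversely, so it
   extends continuously to the centre. *)
Lemma osgood G a r M : 0 < r ->
  (forall z, cmod (z - a) <= r -> disc_class R 0 r [::] M (fun t => G (z, t))) ->
  (forall t, cmod t <= r -> t != 0 -> disc_class R a r [::] M (fun z => G (z, t))) ->
  differentiable G (a, 0).
Proof.
move=> r0 G2 G1.
have rr : r / 2 <= r by move: r0; clear; lra.
have aa (s : R) : 0 <= s -> cmod (a - a) <= s by rewrite subrr cmod0.
have Ga : disc_class R 0 r [::] M (fun t => G (a, t)) by apply: G2; apply: aa; exact: ltW.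
pose M1 := 4 * M / r; pose M2 := 4 * M1 / r.
have M0 : 0 <= M.
  by have [_ _ _ /(_ 0)] := Ga; rewrite subrr cmod0 => /(_ (ltW r0)); apply: le_trans (cmod_ge0 _ _).
have M20 : 0 <= M2.
  by rewrite divr_ge0 ?(ltW r0) // mulr_ge0 // divr_ge0 ?(ltW r0) // mulr_ge0.
pose Q z t := (G (z, t) - G (a, t)) / (z - a).
have bnd z t : cmod (z - a) <= r -> cmod t <= r -> t != 0 ->
    cmod (G (z, t) - G (a, t)) <= M1 * cmod (z - a).
  move=> zr tr t0; apply: (disc_class_lipschitz _ _ _ _ _ _ a z (G1 t tr t0)) => //.
  by apply: aa; rewrite divr_ge0 // ltW.
have near0 : \forall t \near (0 : CC R), cmod t <= r / 2.
  by apply/nbhs_cmodP; exists (r / 2); [rewrite divr_gt0|move=> t; rewrite subr0 => /ltW].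
have Qclass z : z != a -> cmod (z - a) <= r -> disc_class R 0 r [::] M1 (Q z).
  move=> za zr; have [_ zc zd _] := G2 z zr; have [_ ac ad _] := Ga.
  have za0 : 0 < cmod (z - a) by rewrite cmod_gt0 subr_eq0.
  split; first exact: r0.
  - by move=> t tr; apply: (cvgM (cvgB (zc t tr) (ac t tr)) (cvg_cst _)).
  - move=> t tr t0; apply: (@differentiableM R[i]); last exact: differentiable_cst.
    by apply: (@differentiableB _ _ (CC R)); [exact: zd|exact: ad].
  move=> t; rewrite subr0 => tr; rewrite /Q cmodM cmodV ler_pdivrMr //.
  have [->|t0] := eqVneq t 0; last exact: bnd.
  have z0 : cmod (0 - 0 : CC R) <= r by rewrite subrr cmod0 ltW.
  apply: (closure_bound _ (fun t => G (z, t)) (fun t => G (a, t)) _ _ (zc _ z0) (ac _ z0)).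
  by apply: filterS near0 => s sr s0; apply: bnd => //; exact: le_trans sr rr.
(* The Lipschitz estimate in the first variable is available only off [t = 0]; the value [t = 0] is
   recovered afterwards by continuity of [Q z]. *)
pose D := [set u : CC R * CC R | [/\ u.1 != a, cmod (u.1 - a) <= r / 2, u.2 != 0 & cmod u.2 <= r / 2]].
have [q0 qP] : exists q0, forall u, D u -> cmod (Q u.1 u.2 - q0) <= 2 * (M2 * (cmod (u.1 - a) + cmod u.2)).
  apply: (cauchy_bound _ _ D (fun u => Q u.1 u.2) (fun u => M2 * (cmod (u.1 - a) + cmod u.2))).
    have hr : 0 < r / 2 by rewrite divr_gt0.
    pose y : CC R := ((r / 2)%:C)%C.
    have yr : cmod y = r / 2 by rewrite cmodR gtr0_norm.
    have y0 : y != 0 by rewrite -cmod_gt0 yr.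
    have ya : a + y - a = y by rewrite addrC addKr.
    by exists (a + y, y); split; rewrite /= ?ya ?yr //; rewrite -subr_eq0 ya.
  move=> [z t] [z' t'] [/= za zr t0 tr] [/= za' zr' t0' tr'].
  have e1 : cmod (Q z t - Q z' t) <= M2 * cmod (z - z').
    have h0 : cmod (a - a) <= r / 2 by apply: aa; rewrite divr_ge0 // ltW.
    have cl := dq_class _ _ _ _ _ _ _ (G1 t (le_trans tr rr) t0) h0 isT.
    have := disc_class_lipschitz _ _ _ _ _ _ z' z cl zr'.
    by rewrite mem_seq1 za' !dqE // => /(_ isT (le_trans zr rr)).
  have e2 : cmod (Q z' t - Q z' t') <= M2 * cmod (t - t').
    apply: (disc_class_lipschitz _ _ _ _ _ _ t' t (Qclass z' za' (le_trans zr' rr))) => //.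
      by rewrite subr0.
    by rewrite subr0 (le_trans tr rr).
  have e3 := cmodD _ (Q z t - Q z' t) (Q z' t - Q z' t').
  rewrite addrA subrK in e3; apply: le_trans e3 _; apply: le_trans (lerD e1 e2) _.
  rewrite -!mulrDr ler_wpM2l //.
  have := cmodD _ (z - a) (a - z'); rewrite addrA subrK (cmodB _ a).
  have := cmodD _ t (- t'); rewrite cmodN; clear; lra.
have qP0 z t : z != a -> cmod (z - a) <= r / 2 -> cmod t <= r / 2 ->
    cmod (Q z t - q0) <= 2 * (M2 * (cmod (z - a) + cmod t)).
  move=> za zr tr; have [->|t0] := eqVneq t 0; last by apply: (qP (z, t)); split.
  apply/ler_addgt0Pr => e e0; rewrite cmod0 addr0.
  have [_ Qc _ _] := Qclass z za (le_trans zr rr).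
  have z0 : cmod (0 - 0 : CC R) <= r by rewrite subrr cmod0 ltW.
  apply: (closure_bound _ (Q z) (fun=> q0) _ _ (Qc _ z0)); first exact: cst_continuous.
  have M21 : 0 < 2 * M2 + 1 by move: M20; clear; lra.
  have ne : \forall s \near (0 : CC R), cmod s <= e / (2 * M2 + 1).
    apply/nbhs_cmodP; exists (e / (2 * M2 + 1)); first by rewrite divr_gt0.
    by move=> s; rewrite subr0 => /ltW.
  apply: filterS2 near0 ne => s sr se s0; apply: le_trans (qP (z, s) _) _; first by split.
  rewrite /= mulrDr mulrDr lerD2l; move: se; rewrite ler_pdivlMr //.
  by have := cmod_ge0 _ s; clear; lra.
have dGa : differentiable (fun t => G (a, t)) 0.
  by have [_ _ h _] := Ga; apply: h; rewrite ?subrr ?cmod0.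
have [b bP] : exists b, has_cderiv (fun t => G (a, t)) 0 b.
  by exists ('D_1 (fun t => G (a, t) : CC R) 0); exact: differentiable_has_cderiv.
apply: (has_cderiv2_differentiable _ G a 0 q0 b) => e e0.
have [d d0 dP] := bP e e0.
have M21 : 0 < 4 * M2 + 1 by move: M20; clear; lra.
exists (Num.min d (Num.min (r / 2) (e / (4 * M2 + 1)))).
  by rewrite !lt_min d0 (divr_gt0 r0) // divr_gt0.
move=> h k; rewrite !lt_min => /andP[hd /andP[hr he]] /andP[kd /andP[kr ke]].
have k1 := dP k kd; rewrite !add0r in k1 *.
(* The horizontal increment at height [k] is governed by [q0] uniformly in [k], the vertical one at
   [a] by the derivative [b]. *)
have -> : G (a + h, k) - G (a, 0) - q0 * h - b * k =
    (G (a + h, k) - G (a, k) - q0 * h) + (G (a, k) - G (a, 0) - b * k) by ring.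
apply: le_trans (cmodD _ _ _) _; rewrite mulrDr lerD //.
have [->|h0] := eqVneq h 0; first by rewrite addr0 subrr mulr0 subr0 cmod0 mulr0.
have hE : a + h - a = h by rewrite addrC addKr.
have := qP0 (a + h) k; rewrite -subr_eq0 hE => /(_ h0 (ltW hr) (ltW kr)).
rewrite /Q hE => q1.
have -> : G (a + h, k) - G (a, k) - q0 * h = ((G (a + h, k) - G (a, k)) / h - q0) * h.
  by rewrite mulrBl divfK.
rewrite cmodM ler_wpM2r ?cmod_ge0 //; apply: le_trans q1 _.
move: he ke; rewrite !ltr_pdivlMr // => he ke.
have := cmod_ge0 _ h; have := cmod_ge0 _ k; move: he ke; clear; lra.
Qed.
End Division.

(** * Division along a line *)

Section DivisionTheorem.
Variable R : realType.
Implicit Types (x y z w t a b c p : CC R) (r M e : R) (A B : set (CC R)).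
Implicit Types (F G : CC R * CC R -> CC R) (u : CC R * CC R).

Lemma differentiable_fst u : differentiable (fst : CC R * CC R -> CC R) u.
Proof. by apply: linear_differentiable => v; exact: cvg_fst. Qed.

Lemma differentiable_snd u : differentiable (snd : CC R * CC R -> CC R) u.
Proof. by apply: linear_differentiable => v; exact: cvg_snd. Qed.

Lemma differentiable_comp2 F (f g : CC R * CC R -> CC R) u :
  differentiable f u -> differentiable g u -> differentiable F (f u, g u) ->
  differentiable (fun v => F (f v, g v)) u.
Proof.
move=> df dg dF; apply: (differentiable_comp (f := fun v => (f v, g v))) dF.
exact: differentiable_pair.
Qed.

Lemma differentiable_slicel F z t : differentiable F (z, t) -> differentiable (fun z => F (z, t)) z.
Proof.
move=> dF; apply: (differentiable_comp (f := fun v : CC R => (v, t))) dF.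
by apply: differentiable_pair; [exact: ex_diff|exact: differentiable_cst].
Qed.

Lemma differentiable_slicer F z t : differentiable F (z, t) -> differentiable (fun t => F (z, t)) t.
Proof.
move=> dF; apply: (differentiable_comp (f := fun v : CC R => (z, v))) dF.
by apply: differentiable_pair; [exact: differentiable_cst|exact: ex_diff].
Qed.

(** Off [t = 0] this is an honest quotient. On [t = 0] Osgood's lemma applies: slices in [t] are
    difference quotients with their singularity removed, and slices in [z] at [t != 0] are honest
    quotients. The slice [t = 0] consists of derivatives in [t], whose holomorphy in [z] is not
    known beforehand; this is why [osgood] asks for slices at nonzero [t] only. *)
Lemma dq_holo2 (W : set (CC R * CC R)) F : open W -> (forall z t, W (z, t) -> W (z, 0)) ->
  holo2 W F -> holo2 W (fun u => dq R (fun t => F (u.1, t)) 0 u.2).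
Proof.
move=> Wo W0 Fd [a t0] Wat.
have [t00|t00] := eqVneq t0 0; last first.
  apply: (near_eq_differentiable _ _ _ _ (fun u => (F u - F (u.1, 0)) / u.2)).
    have : \forall v \near (a, t0), v.2 != 0.
      have := near_neq _ _ _ t00 => /nbhs_cmodP[d d0 dP].
      by apply/nbhs2_cmodP; exists d => // v _; exact: dP.
    by apply: filterS => -[v1 v2] /= v0; rewrite dqE // subr0.
  apply: (@differentiableM R[i]); last by apply: (@differentiableV R[i]) => //; exact: differentiable_snd.
  apply: (@differentiableB _ _ (CC R)); first exact: Fd.
  apply: (differentiable_comp2 F fst (cst 0)); [exact: differentiable_fst|exact: differentiable_cst|].
  by apply: Fd; apply: W0 Wat.
rewrite t00 in Wat *.
have [r1 r10 Wr] : exists2 r1 : R, 0 < r1 & forall v : CC R * CC R, cmod (v.1 - a) < r1 -> cmod (v.2 - 0) < r1 -> W v.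
  by apply/(nbhs2_cmodP _ (a, 0)); exact: open_nbhs_nbhs.
have Fc : {for (a, 0), continuous F} by apply: differentiable_continuous; exact: Fd.
have [r2 r20 Fr] : exists2 r2 : R, 0 < r2 & forall v : CC R * CC R, cmod (v.1 - a) < r2 -> cmod (v.2 - 0) < r2 -> cmod (F v - F (a, 0)) < 1.
  apply/(nbhs2_cmodP _ (a, 0)).
  by apply: (Fc [set w | cmod (w - F (a, 0)) < 1]); apply/nbhs_cmodP; exists 1.
pose r := Num.min r1 r2 / 2; pose M := cmod (F (a, 0)) + 1.
have r0 : 0 < r by rewrite divr_gt0 // lt_min r10.
have [rr1 rr2] : r < r1 /\ r < r2.
  have h : r < Num.min r1 r2 by rewrite /r in r0 *; move: r0; clear; lra.
  by move: h; rewrite lt_min => /andP[].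
have inW z t : cmod (z - a) <= r -> cmod t <= r -> W (z, t).
  by move=> zr tr; apply: Wr => /=; [exact: le_lt_trans rr1|rewrite subr0; exact: le_lt_trans rr1].
have FM z t : cmod (z - a) <= r -> cmod t <= r -> cmod (F (z, t)) <= M.
  move=> zr tr; have := cmod_dist _ (F (a, 0)) (F (z, t)).
  have := Fr (z, t); rewrite /= subr0 => /(_ (le_lt_trans zr rr2) (le_lt_trans tr rr2)).
  by rewrite /M; clear; lra.
have c0 : cmod (0 : CC R) <= r by rewrite cmod0 ltW.
have S2 z : cmod (z - a) <= r -> disc_class R 0 r [::] (4 * M / r) (dq R (fun t => F (z, t)) 0).
  move=> zr; have dF t : cmod (t - 0) <= r -> differentiable (fun t => F (z, t)) t.
    by rewrite subr0 => tr; apply: differentiable_slicer; apply: Fd; apply: inW.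
  have FC : disc_class R 0 r [::] M (fun t => F (z, t)).
    split; [exact: r0|by move=> t /dF /differentiable_continuous|by move=> t /ltW /dF|].
    by move=> t; rewrite subr0 => tr; exact: FM.
  have c0r : cmod (0 - 0 : CC R) <= r / 2 by rewrite subrr cmod0 divr_ge0 // ltW.
  exact: disc_class_removable (dq_class _ _ _ _ _ _ _ FC c0r isT).
apply: (osgood _ _ a r (4 * M / r)) => [//|z zr|t tr t0'] /=; first exact: S2.
have dF z : cmod (z - a) <= r -> differentiable (fun z => dq R (fun s => F (z, s)) 0 t) z.
  move=> zr.
  have -> : (fun z => dq R (fun s => F (z, s)) 0 t) = (fun z => (F (z, t) - F (z, 0)) / t).
    by apply/funext => s; rewrite dqE // subr0.
  apply: (@differentiableM R[i]); last exact: differentiable_cst.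
  by apply: (@differentiableB _ _ (CC R)); apply: differentiable_slicel; apply: Fd; apply: inW.
split; [exact: r0|by move=> z /dF /differentiable_continuous|by move=> z /ltW /dF|].
by move=> z zr; have [_ _ _] := S2 z zr; apply; rewrite subr0.
Qed.

Lemma open_comp2 A B (f : CC R * CC R -> CC R * CC R) : open A -> open B ->
  continuous f -> open (f @^-1` (A `*` B)).
Proof.
move=> Ao Bo fc; apply: open_comp; first by move=> u _; exact: fc.
rewrite openE => -[z w] [/= Az Bw]; exists (A, B) => //=.
by split; exact: open_nbhs_nbhs.
Qed.

(** The shear [T c] straightens the line to [t = 0], where the quotient is a difference quotient in
    [t]. The inclusion of [c A] in [B] puts the foot [(z, 0)] of every point into the sheared
    domain. *)
Lemma division_holo2 A B c F : open A -> open B -> (forall z, A z -> B (c * z)) ->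
  holo2 (A `*` B) F -> (forall z, A z -> F (z, c * z) = 0) ->
  exists2 G, holo2 (A `*` B) G & forall u, (A `*` B) u -> F u = (u.2 - c * u.1) * G u.
Proof.
move=> Ao Bo AB Fd F0.
pose T (s : CC R) u : CC R * CC R := (u.1, u.2 + s * u.1).
have dT2 s u : differentiable (fun u : CC R * CC R => u.2 + s * u.1 : CC R) u.
  apply: (@differentiableD _ _ (CC R)); first exact: differentiable_snd.
  by apply: (@differentiableM R[i]); [exact: differentiable_cst|exact: differentiable_fst].
have dT s u : differentiable (T s) u.
  by apply: differentiable_pair; [exact: differentiable_fst|exact: dT2].
pose W := T c @^-1` (A `*` B).
have Wo : open W by apply: open_comp2 => // u; exact: differentiable_continuous.
have W0 z t : W (z, t) -> W (z, 0).
  by move=> [/= Az _]; split; rewrite /= ?add0r //; exact: AB.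
have FTd : holo2 W (F \o T c).
  by move=> u Wu; apply: differentiable_comp; [exact: dT|exact: Fd].
have Gd := dq_holo2 _ _ Wo W0 FTd.
set G := (fun u => _) in Gd.
exists (G \o T (- c)) => [u ABu|[z w] [/= Az Bw]].
  apply: differentiable_comp; first exact: dT.
  by apply: Gd; case: u ABu => z w [/= Az Bw]; split; rewrite /= // mulNr subrK.
by rewrite /G /= mulNr -[X in X * _]subr0 dqK /= /T /= subrK add0r F0 // subr0.

Qed.

Lemma division_holo2_swap A B c F : open A -> open B -> (forall w, B w -> A (c * w)) ->
  holo2 (A `*` B) F -> (forall w, B w -> F (c * w, w) = 0) ->
  exists2 G, holo2 (A `*` B) G & forall u, (A `*` B) u -> F u = (u.1 - c * u.2) * G u.
Proof.
move=> Ao Bo BA Fd F0.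
pose sw u : CC R * CC R := (u.2, u.1).
have dsw u : differentiable sw u.
  by apply: differentiable_pair; [exact: differentiable_snd|exact: differentiable_fst].
have [||G Gd GE] := division_holo2 B A c (F \o sw) Bo Ao BA.
- by move=> [w z] [/= Bw Az]; apply: differentiable_comp; [exact: dsw|exact: Fd].
- by move=> w Bw; exact: F0.
exists (G \o sw) => [[z w] [/= Az Bw]|[z w] [/= Az Bw]].
  by apply: differentiable_comp; [exact: dsw|exact: Gd].
exact: (GE (w, z) (conj Bw Az)).
Qed.
End DivisionTheorem.

(** * Holomorphic functions: closure properties, cancellation, bounds for quotients *)

Section Holomorphic.
Variable R : realType.
Implicit Types (x y z w t a b c p : CC R) (r M : R) (A B V : set (CC R)).
Implicit Types (F G : CC R * CC R -> CC R) (f g : CC R -> CC R) (D : set (CC R * CC R)).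

Lemma holo2_cst D c : holo2 D (fun=> c).
Proof. by move=> u _; exact: differentiable_cst. Qed.

Lemma holo2D D F G : holo2 D F -> holo2 D G -> holo2 D (fun u => F u + G u).
Proof. by move=> Fd Gd u Du; apply: (@differentiableD _ _ (CC R)); [exact: Fd|exact: Gd]. Qed.

Lemma holo2M D F G : holo2 D F -> holo2 D G -> holo2 D (fun u => F u * G u).
Proof. by move=> Fd Gd u Du; apply: (@differentiableM R[i]); [exact: Fd|exact: Gd]. Qed.

Lemma holo2_comp1 D V f G : holo1 V f -> holo2 D G -> (forall u, D u -> V (G u)) ->
  holo2 D (fun u => f (G u)).
Proof.
by move=> fd Gd DV u Du; apply: (differentiable_comp (f := G)); [exact: Gd|apply: fd; exact: DV].
Qed.

Lemma holo2_fst D : holo2 D fst.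
Proof. by move=> u _; exact: differentiable_fst. Qed.

Lemma holo2_snd D : holo2 D snd.
Proof. by move=> u _; exact: differentiable_snd. Qed.

Lemma holo1_comp2 V D F f g : holo1 V f -> holo1 V g -> holo2 D F ->
  (forall z, V z -> D (f z, g z)) -> holo1 V (fun z => F (f z, g z)).
Proof.
move=> fd gd Fd VD z Vz; apply: (differentiable_comp (f := fun v => (f v, g v))).
  by apply: differentiable_pair; [exact: fd|exact: gd].
by apply: Fd; exact: VD.
Qed.

Lemma holo1_cst V c : holo1 V (fun=> c).
Proof. by move=> z _; exact: differentiable_cst. Qed.

Lemma holo1_id V : holo1 V id.
Proof. by move=> z _; exact: ex_diff. Qed.

Lemma holo1M V f g : holo1 V f -> holo1 V g -> holo1 V (fun z => f z * g z).
Proof. by move=> fd gd z Vz; apply: (@differentiableM R[i]); [exact: fd|exact: gd]. Qed.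

Lemma holo1D V f g : holo1 V f -> holo1 V g -> holo1 V (fun z => f z + g z).
Proof. by move=> fd gd z Vz; apply: (@differentiableD _ _ (CC R)); [exact: fd|exact: gd]. Qed.

Lemma holo2_slicel A B F w : holo2 (A `*` B) F -> B w -> holo1 A (fun z => F (z, w)).
Proof. by move=> Fd Bw z Az; apply: differentiable_slicel; exact: Fd. Qed.

Lemma holo2_slicer A B F z : holo2 (A `*` B) F -> A z -> holo1 B (fun w => F (z, w)).
Proof. by move=> Fd Az w Bw; apply: differentiable_slicer; exact: Fd. Qed.

Lemma open_cdisc V z : open V -> V z ->
  exists2 r : R, 0 < r & forall w, cmod (w - z) <= r -> V w.
Proof.
move=> Vo /((open_cmodP _ _).1 Vo)[e e0 eV]; exists (e / 2); first by rewrite divr_gt0.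
by move=> w wz; apply: eV; apply: le_lt_trans wz _; rewrite ltr_pdivrMr // ltr_pMr // ltr1n.
Qed.

Lemma dq_holo1 V f z : open V -> V z -> holo1 V f -> holo1 V (dq R f z).
Proof.
move=> Vo Vz fd w Vw; have [->|wz] := eqVneq w z; last first.
  by apply: dq_differentiable => //; exact: fd.
have [r r0 rV] := open_cdisc _ _ Vo Vz.
apply: (removable_singularity _ _ _ r r0) => [v /ltW/rV Vv|v /ltW/rV Vv vz].
  have [->|vz] := eqVneq v z; first by apply: dq_continuous_at; exact: fd.
  by apply: dq_continuous_off => //; apply: differentiable_continuous; exact: fd.
by apply: dq_differentiable => //; exact: fd.
Qed.

Lemma holo1_ext_at V f g v z : open V -> holo1 V f -> holo1 V g ->
  (forall w, V w -> w != v -> f w = g w) -> V z -> f z = g z.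
Proof.
move=> Vo fd gd fg Vz; have [zv|] := eqVneq z v; last exact: fg.
apply/eqP; rewrite -subr_eq0 -cmod_eq0 eq_le cmod_ge0 andbT.
apply: closure_bound; try by apply: differentiable_continuous; [exact: fd|exact: gd].
- by apply: differentiable_continuous; exact: fd.
- by apply: differentiable_continuous; exact: gd.
have nV : \forall w \near z, V w by exact: open_nbhs_nbhs.
by apply: filterS nV => w Vw wz; rewrite fg ?subrr ?cmod0 // -zv.
Qed.

(** Off [v] the factor is invertible, and continuity carries the equality to [v]. This replaces an
    identity theorem on a possibly disconnected [V]. *)
Lemma holo1_cancel V f g v z : open V -> holo1 V f -> holo1 V g ->
  (forall w, V w -> (w - v) * f w = (w - v) * g w) -> V z -> f z = g z.
Proof.
move=> Vo fd gd fg; apply: (holo1_ext_at V f g v z) => // w Vw wv.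
by apply: (mulfI _ (fg _ Vw)); rewrite subr_eq0.
Qed.

Lemma holo1_cancel0 V f g z : open V -> holo1 V f -> holo1 V g ->
  (forall w, V w -> w * f w = w * g w) -> V z -> f z = g z.
Proof.
by move=> Vo fd gd fg; apply: (holo1_cancel V f g 0) => // w Vw; rewrite subr0; exact: fg.
Qed.

Lemma dq_factor V f g z : open V -> V 0 -> holo1 V f -> holo1 V g ->
  (forall w, V w -> f w = w * g w) -> V z -> dq R f 0 z = g z.
Proof.
move=> Vo V0 fd gd fg; apply: holo1_cancel0 => //; first exact: dq_holo1.
by move=> w Vw; rewrite -{1}(subr0 w) dqK !fg // mul0r subr0.
Qed.

Lemma dq_factorK f z : f 0 = 0 -> z * dq R f 0 z = f z.
Proof. by move=> f0; rewrite -{1}(subr0 z) dqK f0 subr0. Qed.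

(** Where [cmod z >= r] one divides; inside the disc [max_modulus] transfers the bound from the
    circle. Division by the coordinate is thereby continuous once the disc is added to the compact
    set. *)
Lemma dq_bound V K f r M : open V -> V 0 -> holo1 V f -> f 0 = 0 -> 0 < r ->
  (forall z, cmod z <= r -> V z) -> K `<=` V -> (forall z, K z -> cmod (f z) <= M) ->
  (forall z, cmod z <= r -> cmod (f z) <= M) ->
  forall z, K z -> cmod (dq R f 0 z) <= M / r.
Proof.
move=> Vo V0 fd f0 r0 rV KV fK fr.
have far z : r <= cmod z -> cmod (f z) <= M -> cmod (dq R f 0 z) <= M / r.
  move=> rz fz; have z0 : 0 < cmod z := lt_le_trans r0 rz.
  rewrite ler_pdivlMr //; apply: le_trans fz; rewrite -(dq_factorK f z f0) cmodM mulrC.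
  by rewrite ler_wpM2r ?cmod_ge0.
have dd := dq_holo1 _ _ _ Vo V0 fd.
move=> z Kz; have [rz|zr] := leP r (cmod z); first by apply: far => //; exact: fK.
apply: (max_modulus _ _ 0 r [::] _ r0) => [w|w|w|]; rewrite subr0.
- by move=> wr; apply: differentiable_continuous; apply: dd; exact: rV.
- by move=> /ltW wr _; apply: dd; exact: rV.
- by move=> wr; apply: far; [rewrite wr|apply: fr; rewrite wr].
exact: ltW.
Qed.

(** Reduces slopes along oblique lines to slopes along the axes, where the gluing conditions of
    [inQ] give information. *)
Lemma derive_line (F : CC R * CC R -> CC R) (a b : CC R) : differentiable F (0, 0) ->
  'D_1 (fun z => F (a * z, b * z)) 0 = a * 'D_1 (fun z => F (z, 0)) 0 + b * 'D_1 (fun z => F (0, z)) 0.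
Proof.
move=> dF.
have line (c e : CC R) : 'D_1 (fun z => F (c * z, e * z)) 0 = 'd F (0, 0) (c, e).
  pose T (z : CC R) : CC R * CC R := (c *: z, e *: z).
  have dT : is_diff (0 : CC R) T T by apply: is_diff_pair.
  have T0 : T 0 = (0, 0) by rewrite /T !scaler0.
  have dF' : differentiable F (T 0) by rewrite T0.
  have T1 : T 1 = (c, e) by congr (_, _); exact: mulr1.
  have dTd : differentiable T (0 : CC R) by exact: ex_diff.
  have dTE : 'd T (0 : CC R) = T :> (CC R -> CC R * CC R) by exact: diff_val.
  have FT : (fun z => F (c * z, e * z)) = F \o T by [].
  have dFT : differentiable (F \o T) (0 : CC R) by exact: differentiable_comp dTd dF'.
  have X := deriveE (1 : CC R) dFT.
  rewrite FT. rewrite X.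
  by rewrite (diff_comp dTd dF') /= dTE T0 T1.
have -> : (fun z => F (z, 0)) = (fun z => F (1 * z, 0 * z)).
  by apply/funext => z; rewrite mul1r mul0r.
have -> : (fun z => F (0, z)) = (fun z => F (0 * z, 1 * z)).
  by apply/funext => z; rewrite mul1r mul0r.
rewrite !line.
have -> : (a, b) = a *: ((1, 0) : CC R * CC R) + b *: ((0, 1) : CC R * CC R).
  congr (_, _).
    by rewrite /= scaler0 addr0 [a *: 1]mulr1.
  by rewrite /= scaler0 add0r [b *: 1]mulr1.
by rewrite linearD !linearZ.
Qed.

Lemma division_holo2_0 A B F : open A -> open B -> B 0 -> holo2 (A `*` B) F ->
  (forall z, A z -> F (z, 0) = 0) ->
  exists2 G, holo2 (A `*` B) G & forall u, (A `*` B) u -> F u = u.2 * G u.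
Proof.
move=> Ao Bo B0 Fd F0.
have AB z : A z -> B (0 * z) by rewrite mul0r.
have F0' z : A z -> F (z, 0 * z) = 0 by rewrite mul0r; exact: F0.
have [G Gd GE] := division_holo2 R A B 0 F Ao Bo AB Fd F0'.
by exists G => // u /GE; rewrite mul0r subr0.
Qed.

Lemma compact_cmod_bound A : compact A -> exists2 N : R, 0 < N & forall z, A z -> cmod z <= N.
Proof.
move=> Ac; have [->|A0] := eqVneq A set0; first by exists 1.
have cc : {within A, continuous (@cmod R)}.
  by apply: continuous_subspaceT; exact: cmod_continuous.
have [c _ cP] := compact_EVT_max ((set0P _).1 A0) Ac cc.
exists (cmod c + 1); first by rewrite ltr_wpDl // cmod_ge0.
by move=> z Az; apply: le_trans (cP z _) _; rewrite ?inE // lerDl.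
Qed.

Lemma compact_scale A c : compact A -> compact [set c * z | z in A].
Proof.
move=> Ac; apply: continuous_compact => //; apply: continuous_subspaceT => z.
by apply: differentiable_continuous; apply: (@differentiableM R[i]);
  [exact: differentiable_cst|exact: ex_diff].
Qed.
End Holomorphic.

(** * The spaces O(U) and Q(U) *)

Section Quadruples.
Variables (R : realType) (Ux Uy : set (CC R)).
Implicit Types (x y : Quad R) (a e : CC R) (K L : set (CC R)).
Local Notation inQU := (inQ Ux Uy).

Lemma inQ_add x y : inQU x -> inQU y -> inQU (addQ x y).
Proof.
move=> [x1 x2 x3 x4 [a1 a2 a3 a4]] [y1 y2 y3 y4 [b1 b2 b3 b4]].
split; try exact: holo2D; split=> /= z Uz.
- by rewrite a1 // b1.
- by rewrite a2 // b2.
- by rewrite a3 // b3.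
- by rewrite a4 // b4.
Qed.

Lemma inQ_scale a x : inQU x -> inQU (scaleQ a x).
Proof.
move=> [x1 x2 x3 x4 [a1 a2 a3 a4]].
split; try (apply: holo2M => //; exact: holo2_cst); split=> /= z Uz.
- by rewrite a1.
- by rewrite a2.
- by rewrite a3.
- by rewrite a4.
Qed.

Lemma inQ_sub x y : inQU x -> inQU y -> inQU (subQ x y).
Proof. by move=> Qx Qy; exact: (inQ_add _ _ Qx (inQ_scale (-1) _ Qy)). Qed.

Lemma inQ_mz1 x : inQU x -> inQU (mz1 x).
Proof.
move=> [x1 x2 x3 x4 [a1 a2 a3 a4]].
split; try exact: holo2_cst; try (apply: holo2M => //; exact: holo2_fst).
by split=> /= z Uz; rewrite ?mul0r ?a1.
Qed.

Lemma inQ_mz2 x : inQU x -> inQU (mz2 x).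
Proof.
move=> [x1 x2 x3 x4 [a1 a2 a3 a4]].
split; try exact: holo2_cst; try (apply: holo2M => //; exact: holo2_snd).
by split=> /= z Uz; rewrite ?mul0r ?a3.
Qed.

Lemma inQ_mw1 x : inQU x -> inQU (mw1 x).
Proof.
move=> [x1 x2 x3 x4 [a1 a2 a3 a4]].
split; try exact: holo2_cst; try (apply: holo2M => //; exact: holo2_fst).
by split=> /= z Uz; rewrite ?mul0r ?a2.
Qed.

Lemma inQ_mw2 x : inQU x -> inQU (mw2 x).
Proof.
move=> [x1 x2 x3 x4 [a1 a2 a3 a4]].
split; try exact: holo2_cst; try (apply: holo2M => //; exact: holo2_snd).
by split=> /= z Uz; rewrite ?mul0r ?a4.
Qed.

Lemma nbQ_add K L e1 e2 x y : nbQ K L e1 x -> nbQ K L e2 y -> nbQ K L (e1 + e2) (addQ x y).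
Proof.
move=> [x1 x2 x3 x4] [y1 y2 y3 y4].
by split=> p Kp; apply: le_trans (ler_normD _ _) (lerD _ _); auto.
Qed.

Lemma nbQ_scale K L e a x : `|a| <= 1 -> nbQ K L e x -> nbQ K L e (scaleQ a x).
Proof.
move=> a1 [x1 x2 x3 x4].
by split=> p Kp /=; rewrite normrM -[e]mul1r ler_pM //; auto.
Qed.

Lemma nbQ_sub K L e1 e2 x y : nbQ K L e1 x -> nbQ K L e2 y -> nbQ K L (e1 + e2) (subQ x y).
Proof. by move=> hx hy; apply: nbQ_add => //; apply: nbQ_scale => //; rewrite normrN normr1. Qed.

Lemma nbQ_mul K L (e N : CC R) x : 0 <= N -> 0 <= e -> (forall z, K z -> `|z| <= N) ->
  (forall z, L z -> `|z| <= N) -> nbQ K L e x ->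
  [/\ nbQ K L (N * e) (mz1 x), nbQ K L (N * e) (mz2 x),
      nbQ K L (N * e) (mw1 x) & nbQ K L (N * e) (mw2 x)].
Proof.
move=> N0 e0 KN LN [x1 x2 x3 x4].
split; split=> -[z w] [/= hz hw] /=; rewrite ?normr0 ?mulr_ge0 // normrM ler_pM //;
  by [apply: KN|apply: LN|apply: x1|apply: x2|apply: x3|apply: x4].
Qed.

Lemma compacts_bound K L : compact K -> compact L -> exists N : CC R,
  [/\ 0 < N, forall z, K z -> `|z| <= N & forall z, L z -> `|z| <= N].
Proof.
move=> /compact_cmod_bound[N1 N10 h1] /compact_cmod_bound[N2 N20 h2].
exists ((N1 + N2)%:C%C); rewrite ltcR addr_gt0 //; split=> // z /[dup] Kz.
  by move=> /h1 zN; rewrite cmodE lecR (le_trans zN) // lerDl ltW.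
by move=> /h2 zN; rewrite cmodE lecR (le_trans zN) // lerDr ltW.
Qed.
End Quadruples.

(** * The sequence *)

Section Sequence.
Variables (R : realType) (q : CC R) (Ux Uy : set (CC R)) (d l : nat).
Hypotheses (hq : 0 < `|q| < 1) (hx : q_open q Ux) (hy : q_open q Uy).
Implicit Types (x y : Quad R) (z w a e : CC R) (K L : set (CC R)).
Local Notation inQU := (inQ Ux Uy).
Local Notation inQQU := (inQQ Ux Uy).
Local Notation inOU := (inO Ux Uy).

Let Uxo : open Ux. Proof. by case: hx. Qed.
Let Uyo : open Uy. Proof. by case: hy. Qed.
Let Ux0 : Ux 0. Proof. by case: hx => _ []. Qed.
Let Uy0 : Uy 0. Proof. by case: hy => _ []. Qed.

Let Uxq n z : Ux z -> Ux (q ^+ n * z).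
Proof.
move=> Uz; elim: n => [|n IH]; first by rewrite mul1r.
by rewrite exprS -mulrA; case: hx => _ [_]; apply.
Qed.

Let Uyq n z : Uy z -> Uy (q ^+ n * z).
Proof.
move=> Uz; elim: n => [|n IH]; first by rewrite mul1r.
by rewrite exprS -mulrA; case: hy => _ [_]; apply.
Qed.

Let q0 : q != 0. Proof. by case/andP: hq; rewrite normr_gt0. Qed.
Let qn0 n : q ^+ n != 0. Proof. by rewrite expf_neq0. Qed.

Let qn1 n : `|q ^+ n| <= 1.
Proof. by rewrite normrX exprn_ile1 //; case/andP: hq => _ /ltW. Qed.

(** * The complex: well-definedness, continuity, compositions and H^0 *)

Lemma del0_inQQ x : inQU x -> inQQU (del0 q l d x).
Proof.
move=> Qx; split; apply: inQ_sub.
- exact: inQ_mw1.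
- by apply: inQ_scale; exact: inQ_mw2.
- exact: inQ_mz2.
- by apply: inQ_scale; exact: inQ_mz1.
Qed.

Lemma del1_inQ (x : QQ R) : inQQU x -> inQU (del1 q l d x).
Proof.
move=> [Q1 Q2]; apply: inQ_add; apply: inQ_sub.
- exact: inQ_mz2.
- by apply: inQ_scale; exact: inQ_mz1.
- by apply: inQ_scale; exact: inQ_mw2.
- exact: inQ_mw1.
Qed.

Lemma holo1_line (F : CC R * CC R -> CC R) n : holo2 (Ux `*` Ux) F ->
  holo1 Ux (fun z => F (z, q ^+ n * z)).
Proof.
move=> Fd; apply: (holo1_comp2 R Ux _ F id (fun z => q ^+ n * z) _ _ Fd).
- exact: holo1_id.
- by apply: holo1M; [exact: holo1_cst|exact: holo1_id].
by move=> z Uz; split=> //=; exact: Uxq.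
Qed.

Lemma holo1_line_swap (F : CC R * CC R -> CC R) n : holo2 (Uy `*` Uy) F ->
  holo1 Uy (fun w => F (q ^+ n * w, w)).
Proof.
move=> Fd; apply: (holo1_comp2 R Uy _ F (fun z => q ^+ n * z) id _ _ Fd).
- by apply: holo1M; [exact: holo1_cst|exact: holo1_id].
- exact: holo1_id.
by move=> z Uz; split=> //=; exact: Uyq.
Qed.

Lemma inQ_origin x : inQU x -> qc1 x (0, 0) = qc4 x (0, 0).
Proof. by move=> [_ _ _ _ [h1 h2 h3 h4]]; rewrite h1 // h4. Qed.

Lemma pi_inO x : inQU x -> inOU (pi_dl q d l x).
Proof.
move=> Qx; have [x1 _ _ x4 _] := Qx; split => /=.
- exact: holo1_line.
- exact: holo1_line_swap.
- by rewrite !mulr0 inQ_origin.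
Qed.

Lemma del0_continuous : lin_continuous Ux Uy inQU (@nbQ R) (@nbQQ R) (del0 q l d).
Proof.
move=> K L e [Kc KU] [Lc LU] e0; have [N [N0 KN LN]] := compacts_bound _ _ _ Kc Lc.
have N2 : 0 < N * 2 by rewrite mulr_gt0.
exists K, L, (e / (N * 2)); split=> //; first by rewrite divr_gt0.
move=> x _ hx'; have [m1 m2 m3 m4] := nbQ_mul _ _ _ _ _ _ (ltW N0) (ltW (divr_gt0 e0 N2)) KN LN hx'.
have eE : e = N * (e / (N * 2)) + N * (e / (N * 2)) by field; rewrite gt_eqF.
by split; rewrite eE; apply: nbQ_sub => //; apply: nbQ_scale.
Qed.

Lemma del1_continuous : lin_continuous Ux Uy inQQU (@nbQQ R) (@nbQ R) (del1 q l d).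
Proof.
move=> K L e [Kc KU] [Lc LU] e0; have [N [N0 KN LN]] := compacts_bound _ _ _ Kc Lc.
have N2 : 0 < N * 4 by rewrite mulr_gt0.
exists K, L, (e / (N * 4)); split=> //; first by rewrite divr_gt0.
move=> x _ [hx1 hx2].
have [m1 m2 m3 m4] := nbQ_mul _ _ _ _ _ _ (ltW N0) (ltW (divr_gt0 e0 N2)) KN LN hx1.
have [n1 n2 n3 n4] := nbQ_mul _ _ _ _ _ _ (ltW N0) (ltW (divr_gt0 e0 N2)) KN LN hx2.
have eE : e = (N * (e / (N * 4)) + N * (e / (N * 4))) + (N * (e / (N * 4)) + N * (e / (N * 4))).
  by field; rewrite gt_eqF.
by rewrite eE; apply: nbQ_add; apply: nbQ_sub => //; apply: nbQ_scale.
Qed.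

Lemma cpt_in_line (V : set (CC R)) K n : (forall z, V z -> V (q ^+ n * z)) -> cpt_in V K ->
  cpt_in V (K `|` [set q ^+ n * z | z in K]).
Proof.
move=> Vq [Kc KV]; split; first by apply: compactU => //; exact: compact_scale.
by move=> z [/KV//|[w /KV Vw <-]]; exact: Vq.
Qed.

Lemma pi_continuous : lin_continuous Ux Uy inQU (@nbQ R) (@nbO R) (pi_dl q d l).
Proof.
move=> K L e Kc Lc e0.
exists (K `|` [set q ^+ d * z | z in K]), (L `|` [set q ^+ l * z | z in L]), e.
split=> //; [by apply: cpt_in_line => // z; exact: Uxq|by apply: cpt_in_line => // z; exact: Uyq|].
move=> x _ [h1 _ _ h4]; split=> [z Kz|w Lw] /=.
  by apply: h1; split; [left|right; exists z].
by apply: h4; split; [right; exists w|left].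
Qed.

Lemma del1_del0 x : eqQ Ux Uy (del1 q l d (del0 q l d x)) (zeroQ R).
Proof. by split=> p _ /=; rewrite ?exprS; ring. Qed.

Lemma pi_del1 (x : QQ R) : eqO Ux Uy (pi_dl q d l (del1 q l d x)) (0, 0).
Proof. by split=> z _ /=; rewrite [RHS]/=; ring. Qed.

Lemma del0_injective x : inQU x -> eqQQ Ux Uy (del0 q l d x) (zeroQ R, zeroQ R) ->
  eqQ Ux Uy x (zeroQ R).
Proof.
move=> [x1 x2 x3 x4 _] [[/= a1 a2 a3 a4] [/= b1 b2 b3 b4]].
split=> -[z w] [/= hz hw].
- apply: (holo1_cancel R Ux (fun s => qc1 x (z, s)) (fun=> 0) (q ^+ d.+1 * z)) => //.
  + exact: (holo2_slicer _ _ _ _ _ x1).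
  by move=> s hs; rewrite mulr0; apply: etrans (b1 (z, s) (conj hz hs)); rewrite /=; ring.
- apply: (holo1_cancel0 R Uy (fun s => qc2 x (z, s)) (fun=> 0)) => //.
  + exact: (holo2_slicer _ _ _ _ _ x2).
  move=> s hs; apply: (mulfI (qn0 l.+1)); have := a2 (z, s) (conj hz hs); rewrite /= !mulr0.
  by move=> /eqP; rewrite add0r mulN1r oppr_eq0 => /eqP.
- apply: (holo1_cancel0 R Ux (fun s => qc3 x (z, s)) (fun=> 0)) => //.
  + exact: (holo2_slicer _ _ _ _ _ x3).
  by move=> s hs; rewrite mulr0; apply: etrans (b3 (z, s) (conj hz hs)); rewrite /=; ring.
- apply: (holo1_cancel R Uy (fun s => qc4 x (s, w)) (fun=> 0) (q ^+ l.+1 * w)) => //.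
  + exact: (holo2_slicel _ _ _ _ _ x4).
  by move=> s hs; rewrite mulr0; apply: etrans (a4 (s, w) (conj hs hw)); rewrite /=; ring.
Qed.

(** * The kernel of [del1] and the map inducing H^1 *)

Let kerd1 (x : QQ R) := inQQU x /\ eqQ Ux Uy (del1 q l d x) (zeroQ R).
Let imd0 (x : QQ R) := exists z : Quad R, inQU z /\ eqQQ Ux Uy (del0 q l d z) x.

(** The quotient [q ^+ d / q ^+ l] stands for [q^(d-l)], whose exponent may be negative. [qc1 x.2]
    and [qc4 x.1] do not appear: [del1] multiplies them by 0, and only gluing constrains them. *)
Record kernel_form (x : QQ R) (f2 f3 : CC R * CC R -> CC R) : Prop := KernelForm {
  kf_holo2 : holo2 (Ux `*` Uy) f2;
  kf_holo3 : holo2 (Uy `*` Ux) f3;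
  kf_z1 : forall z w, Ux z -> Ux w -> qc1 x.1 (z, w) = 0;
  kf_z2 : forall z w, Ux z -> Uy w -> qc2 x.1 (z, w) = w * f2 (z, w);
  kf_z3 : forall z w, Uy z -> Ux w -> qc3 x.1 (z, w) = z * f3 (z, w);
  kf_e2 : forall z w, Ux z -> Uy w -> qc2 x.2 (z, w) = q ^+ d / q ^+ l * (z * f2 (z, w));
  kf_e3 : forall z w, Uy z -> Ux w -> qc3 x.2 (z, w) = w * f3 (z, w);
  kf_e4 : forall z w, Uy z -> Uy w -> qc4 x.2 (z, w) = 0 }.

(** Cancelling linear forms kills zeta_1 and eta_4. By gluing, zeta_2 and eta_3 vanish where their
    second variable is 0, which produces [f2] and [f3]. The mixed components of [del1 x = 0] then
    determine eta_2 and zeta_3. *)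
Lemma kernelP (x : QQ R) : kerd1 x -> exists f2 f3, kernel_form x f2 f3.
Proof.
move=> [[[x1 x2 x3 x4 [a1 a2 a3 a4]] [y1 y2 y3 y4 [b1 b2 b3 b4]]] [k1 k2 k3 k4]].
have z1 z w : Ux z -> Ux w -> qc1 x.1 (z, w) = 0.
  move=> hz; apply: (holo1_cancel R Ux (fun s => qc1 x.1 (z, s)) (fun=> 0) (q ^+ d * z)) => //.
    exact: (holo2_slicer _ _ _ _ _ x1).
  by move=> s hs; rewrite mulr0; apply: etrans (k1 (z, s) (conj hz hs)); rewrite /=; ring.
have e4 z w : Uy z -> Uy w -> qc4 x.2 (z, w) = 0.
  move=> hz hw; apply: (holo1_cancel R Uy (fun s => qc4 x.2 (s, w)) (fun=> 0) (q ^+ l * w)) => //.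
    exact: (holo2_slicel _ _ _ _ _ y4).
  move=> s hs; rewrite mulr0; apply: oppr_inj; rewrite oppr0.
  by apply: etrans (k4 (s, w) (conj hs hw)); rewrite /=; ring.
have [f2 f2d z2] : exists2 G, holo2 (Ux `*` Uy) G & forall u, (Ux `*` Uy) u -> qc2 x.1 u = u.2 * G u.
  by apply: division_holo2_0 => // z hz; rewrite -a1 // z1.
have [f3 f3d e3] : exists2 G, holo2 (Uy `*` Ux) G & forall u, (Uy `*` Ux) u -> qc3 x.2 u = u.2 * G u.
  by apply: division_holo2_0 => // z hz; rewrite b2 // e4.
exists f2, f3; split=> //.
- by move=> z w hz hw; rewrite z2.
- move=> z w hz; apply: (holo1_cancel0 R Ux (fun s => qc3 x.1 (z, s)) (fun s => z * f3 (z, s))) => //.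
  + exact: (holo2_slicer _ _ _ _ _ x3).
  + by apply: holo1M; [exact: holo1_cst|exact: (holo2_slicer _ _ _ _ _ f3d)].
  move=> s hs; rewrite [RHS]mulrCA; have /= <- := e3 (z, s) (conj hz hs).
  by apply/eqP; rewrite -subr_eq0; apply/eqP; apply: etrans (k3 (z, s) (conj hz hs)); rewrite /=; ring.
- move=> z w hz; apply: (holo1_cancel0 R Uy (fun s => qc2 x.2 (z, s)) (fun s => q ^+ d / q ^+ l * (z * f2 (z, s)))) => //.
  + exact: (holo2_slicer _ _ _ _ _ y2).
  + apply: holo1M; first exact: holo1_cst.
    by apply: holo1M; [exact: holo1_cst|exact: (holo2_slicer _ _ _ _ _ f2d)].
  move=> s hs; apply: (mulfI (qn0 l)).
  have /= := k2 (z, s) (conj hz hs); have /= -> := z2 (z, s) (conj hz hs).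
  move=> k; apply/eqP; rewrite -subr_eq0; apply/eqP; apply: etrans k.
  by field; rewrite qn0.
- by move=> z w hz hw; rewrite e3.
Qed.

Let diag1 (x : QQ R) z := qc1 x.2 (z, q ^+ d.+1 * z).
Let diag4 (x : QQ R) w := qc4 x.1 (q ^+ l.+1 * w, w).

(* Both components vanish at the origin on the kernel of [del1]; dividing by the
   coordinate and rescaling makes their values at 0 agree. *)
Definition h1_map (x : QQ R) : Ofun R :=
  (fun z => q ^+ l / q ^+ d * dq R (diag1 x) 0 z, dq R (diag4 x) 0).

Lemma diag1_holo (x : QQ R) : inQQU x -> holo1 Ux (diag1 x).
Proof. by move=> [_ [x1 _ _ _ _]]; exact: holo1_line. Qed.

Lemma diag4_holo (x : QQ R) : inQQU x -> holo1 Uy (diag4 x).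
Proof. by move=> [[_ _ _ x4 _] _]; exact: holo1_line_swap. Qed.

Lemma diag1_0 (x : QQ R) : kerd1 x -> diag1 x 0 = 0.
Proof.
move=> kx; have [f2 [f3 [_ _ _ _ _ _ _ e4]]] := kernelP _ kx.
have [[_ Q2] _] := kx; rewrite /diag1 mulr0 inQ_origin //.
exact: e4.
Qed.

Lemma diag4_0 (x : QQ R) : kerd1 x -> diag4 x 0 = 0.
Proof.
move=> kx; have [f2 [f3 [_ _ z1 _ _ _ _ _]]] := kernelP _ kx.
have [[Q1 _] _] := kx; rewrite /diag4 mulr0 -inQ_origin //.
exact: z1.
Qed.

(** The common value at 0 is [f2 (0, 0) + q ^+ l.+1 * f3 (0, 0)]: the slope of eta_1 is q^(d-l) f2 +
    q^(d+1) f3 at the origin, and the factor [q ^+ l / q ^+ d] turns it into that of zeta_4. *)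
Lemma h1_map_inO (x : QQ R) : kerd1 x -> inOU (h1_map x).
Proof.
move=> kx; have [Qx _] := kx; split=> /=.
- by apply: holo1M; [exact: holo1_cst|apply: dq_holo1 => //; exact: diag1_holo].
- by apply: dq_holo1 => //; exact: diag4_holo.
have [f2 [f3 [f2d f3d z1 z2 z3 e2 e3 e4]]] := kernelP _ kx.
have [[_ _ _ x4 [a1 a2 a3 a4]] [y1 _ _ _ [b1 b2 b3 b4]]] := Qx.
rewrite /dq !eqxx /diag1 /diag4.
have D1 := derive_line R (qc1 x.2) 1 (q ^+ d.+1) (y1 (0, 0) (conj Ux0 Ux0)).
have D4 := derive_line R (qc4 x.1) (q ^+ l.+1) 1 (x4 (0, 0) (conj Uy0 Uy0)).
have -> : (fun z => qc1 x.2 (z, q ^+ d.+1 * z)) = (fun z => qc1 x.2 (1 * z, q ^+ d.+1 * z)).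
  by apply/funext => z; rewrite mul1r.
have -> : (fun w => qc4 x.1 (q ^+ l.+1 * w, w)) = (fun w => qc4 x.1 (q ^+ l.+1 * w, 1 * w)).
  by apply/funext => z; rewrite mul1r.
have slope (V : set (CC R)) (f g : CC R -> CC R) : open V -> V 0 -> holo1 V f -> holo1 V g ->
    (forall z, V z -> f z = z * g z) -> 'D_1 f 0 = g 0.
  by move=> Vo V0 fd gd fg; have := dq_factor R V f g 0 Vo V0 fd gd fg V0; rewrite /dq eqxx.
have s1 : 'D_1 (fun z => qc1 x.2 (z, 0)) 0 = q ^+ d / q ^+ l * f2 (0, 0).
  apply: (slope Ux _ (fun z => q ^+ d / q ^+ l * f2 (z, 0)) Uxo Ux0).
  - exact: (holo2_slicel _ _ _ _ _ y1).
  - by apply: holo1M; [exact: holo1_cst|exact: (holo2_slicel _ _ _ _ _ f2d)].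
  - by move=> z hz; rewrite b1 // e2 // mulrCA.
have s2 : 'D_1 (fun z => qc1 x.2 (0, z)) 0 = f3 (0, 0).
  apply: (slope Ux _ (fun z => f3 (0, z)) Uxo Ux0).
  - exact: (holo2_slicer _ _ _ _ _ y1).
  - exact: (holo2_slicer _ _ _ _ _ f3d).
  - by move=> z hz; rewrite b3 // e3.
have s3 : 'D_1 (fun z => qc4 x.1 (z, 0)) 0 = f3 (0, 0).
  apply: (slope Uy _ (fun z => f3 (z, 0)) Uyo Uy0).
  - exact: (holo2_slicel _ _ _ _ _ x4).
  - exact: (holo2_slicel _ _ _ _ _ f3d).
  - by move=> z hz; rewrite -a2 // z3.
have s4 : 'D_1 (fun z => qc4 x.1 (0, z)) 0 = f2 (0, 0).
  apply: (slope Uy _ (fun z => f2 (0, z)) Uyo Uy0).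
  - exact: (holo2_slicer _ _ _ _ _ x4).
  - exact: (holo2_slicer _ _ _ _ _ f2d).
  - by move=> z hz; rewrite -a4 // z2.
rewrite D1 D4 s1 s2 s3 s4.
by rewrite !exprS; field; rewrite !qn0.
Qed.

Lemma kerd1_comb (a b : CC R) (x y : QQ R) : kerd1 x -> kerd1 y ->
  kerd1 (addQQ (scaleQQ a x) (scaleQQ b y)).
Proof.
move=> [[Qx1 Qx2] [x1 x2 x3 x4]] [[Qy1 Qy2] [y1 y2 y3 y4]].
split; first by split; apply: inQ_add; apply: inQ_scale.
split=> p hp.
- transitivity (a * qc1 (del1 q l d x) p + b * qc1 (del1 q l d y) p); first by rewrite /=; ring.
  by rewrite x1 // y1 // !mulr0 addr0.
- transitivity (a * qc2 (del1 q l d x) p + b * qc2 (del1 q l d y) p); first by rewrite /=; ring.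
  by rewrite x2 // y2 // !mulr0 addr0.
- transitivity (a * qc3 (del1 q l d x) p + b * qc3 (del1 q l d y) p); first by rewrite /=; ring.
  by rewrite x3 // y3 // !mulr0 addr0.
- transitivity (a * qc4 (del1 q l d x) p + b * qc4 (del1 q l d y) p); first by rewrite /=; ring.
  by rewrite x4 // y4 // !mulr0 addr0.
Qed.

Lemma h1_map_comb (a b : CC R) (x y : QQ R) : kerd1 x -> kerd1 y ->
  eqO Ux Uy (h1_map (addQQ (scaleQQ a x) (scaleQQ b y))) (lincombO a (h1_map x) b (h1_map y)).
Proof.
move=> kx ky; have [Qxy _] := kerd1_comb a b _ _ kx ky.
have [Qx _] := kx; have [Qy _] := ky.
have dq1 (u : QQ R) : inQQU u -> holo1 Ux (dq R (diag1 u) 0).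
  by move=> Qu; apply: dq_holo1 => //; exact: diag1_holo.
have dq4 (u : QQ R) : inQQU u -> holo1 Uy (dq R (diag4 u) 0).
  by move=> Qu; apply: dq_holo1 => //; exact: diag4_holo.
pose v := addQQ (scaleQQ a x) (scaleQQ b y).
have E1 z : Ux z -> dq R (diag1 v) 0 z = a * dq R (diag1 x) 0 z + b * dq R (diag1 y) 0 z.
  apply: (dq_factor R Ux _ (fun z => a * dq R (diag1 x) 0 z + b * dq R (diag1 y) 0 z) z Uxo Ux0 (diag1_holo _ Qxy)).
    by apply: holo1D; apply: holo1M; [exact: holo1_cst|exact: dq1|exact: holo1_cst|exact: dq1].
  move=> w hw; rewrite mulrDr (mulrCA w a) (mulrCA w b) dq_factorK ?diag1_0 //.
  by rewrite dq_factorK ?diag1_0.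
have E4 z : Uy z -> dq R (diag4 v) 0 z = a * dq R (diag4 x) 0 z + b * dq R (diag4 y) 0 z.
  apply: (dq_factor R Uy _ (fun z => a * dq R (diag4 x) 0 z + b * dq R (diag4 y) 0 z) z Uyo Uy0 (diag4_holo _ Qxy)).
    by apply: holo1D; apply: holo1M; [exact: holo1_cst|exact: dq4|exact: holo1_cst|exact: dq4].
  move=> w hw; rewrite mulrDr (mulrCA w a) (mulrCA w b) dq_factorK ?diag4_0 //.
  by rewrite dq_factorK ?diag4_0.
split=> z hz; last exact: E4.
transitivity (q ^+ l / q ^+ d * dq R (diag1 v) 0 z); first by [].
rewrite E1 // /lincombO /h1_map /=; move: (dq R (diag1 x) 0 z) (dq R (diag1 y) 0 z) => X Y.
by ring.
Qed.

Lemma h1_map_continuous : lin_continuous Ux Uy kerd1 (@nbQQ R) (@nbO R) h1_map.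
Proof.
move=> K L _ Kc Lc /gt0c_real[e e0 ->].
have [r1 r10 D1] := open_cdisc _ _ _ Uxo Ux0; have [r2 r20 D2] := open_cdisc _ _ _ Uyo Uy0.
pose r := Num.min r1 r2; have r0 : 0 < r by rewrite lt_min r10.
have DUx z : cmod z <= r -> Ux z by rewrite le_min => /andP[zr _]; apply: D1; rewrite subr0.
have DUy z : cmod z <= r -> Uy z by rewrite le_min => /andP[_ zr]; apply: D2; rewrite subr0.
pose D := [set z : CC R | cmod z <= r].
have Dc : compact D.
  have := closed_disc_compact R 0 r; congr compact.
  by apply/seteqP; split=> z; rewrite /= subr0.
have KD : cpt_in Ux (K `|` D).
  by case: Kc => Kc KU; split; [exact: compactU|move=> z [/KU|/DUx]].
have LD : cpt_in Uy (L `|` D).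
  by case: Lc => Lc LU; split; [exact: compactU|move=> z [/LU|/DUy]].
pose k := cmod (q ^+ l / q ^+ d).
have k0 : 0 <= k := cmod_ge0 _ _.
have k1 : 0 < 1 + k by rewrite ltr_pwDl.
(* Division by the coordinate costs [1 / r]; the divisor [1 + k] serves both components, whose
   remaining factors are [k] and 1. *)
pose M := e / (1 + k) * r.
have M0 : 0 < M by rewrite mulr_gt0 // divr_gt0.
have Mr : M / r = e / (1 + k) by rewrite /M mulfK // gt_eqF.
(* [D] is added for [dq_bound], the scaled copy so that both coordinates of a point on the line stay
   in the compact set. *)
exists ((K `|` D) `|` [set q ^+ d.+1 * z | z in K `|` D]),
       ((L `|` D) `|` [set q ^+ l.+1 * z | z in L `|` D]), (M%:C%C).
split; [by apply: cpt_in_line => // z; exact: Uxq|by apply: cpt_in_line => // z; exact: Uyq|by rewrite ltcR|].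
move=> x kx [[_ _ _ n4] [n1 _ _ _]]; have [Qx _] := kx.
have b1 z : (K `|` D) z -> cmod (diag1 x z) <= M.
  by move=> hz; rewrite -lecR -cmodE; apply: n1; split; [left|right; exists z].
have b4 z : (L `|` D) z -> cmod (diag4 x z) <= M.
  by move=> hz; rewrite -lecR -cmodE; apply: n4; split; [right; exists z|left].
split=> z hz /=; rewrite cmodE lecR.
  have : cmod (dq R (diag1 x) 0 z) <= M / r.
    apply: (dq_bound R Ux K _ r M Uxo Ux0 (diag1_holo _ Qx) (diag1_0 _ kx) r0 DUx _ _ _ z hz).
    - by case: Kc.
    - by move=> w Kw; apply: b1; left.
    - by move=> w Dw; apply: b1; right.
  rewrite cmodM -/k Mr => h; apply: (@le_trans _ _ (k * (e / (1 + k)))); first by rewrite ler_wpM2l.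
  by rewrite mulrA ler_pdivrMr // mulrC ler_pM2l // lerDr.
have : cmod (dq R (diag4 x) 0 z) <= M / r.
  apply: (dq_bound R Uy L _ r M Uyo Uy0 (diag4_holo _ Qx) (diag4_0 _ kx) r0 DUy _ _ _ z hz).
  - by case: Lc.
  - by move=> w Kw; apply: b4; left.
  - by move=> w Dw; apply: b4; right.
by rewrite Mr => h; apply: (le_trans h); rewrite ler_pdivrMr // ler_pMr // lerDl.
Qed.
Lemma h1_map_eq0 (x : QQ R) : kerd1 x -> eqO Ux Uy (h1_map x) (0, 0) <-> imd0 x.
Proof.
move=> kx; have [Qx _] := kx; split; last first.
  move=> [z [Qz [[_ _ _ A4] [B1 _ _ _]]]].
  have D1 w : Ux w -> diag1 x w = w * 0.
    by move=> hw; rewrite /diag1 -B1; [rewrite /=; ring|split=> //=; exact: Uxq].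
  have D4 w : Uy w -> diag4 x w = w * 0.
    by move=> hw; rewrite /diag4 -A4; [rewrite /=; ring|split=> //=; exact: Uyq].
  split=> w hw; rewrite /h1_map /=.
    rewrite (dq_factor R Ux _ (fun=> 0) w Uxo Ux0 (diag1_holo _ Qx) (holo1_cst _ _ _) D1 hw).
    by rewrite mulr0.
  exact: (dq_factor R Uy _ (fun=> 0) w Uyo Uy0 (diag4_holo _ Qx) (holo1_cst _ _ _) D4 hw).
move=> [P1 P4].
have D1 z : Ux z -> diag1 x z = 0.
  move=> hz; rewrite -(dq_factorK R _ z (diag1_0 _ kx)).
  have /eqP := P1 z hz; rewrite /h1_map /= mulf_eq0 mulf_eq0 invr_eq0 !(negPf (qn0 _)) /= => /eqP ->.
  exact: mulr0.
have D4 w : Uy w -> diag4 x w = 0.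
  move=> hw; rewrite -(dq_factorK R _ w (diag4_0 _ kx)).
  by have -> : dq R (diag4 x) 0 w = 0 := P4 w hw; rewrite mulr0.
have [f2 [f3 [f2d f3d z1 z2 z3 e2 e3 e4]]] := kernelP _ kx.
have [[_ _ _ x4 [a1 a2 a3 a4]] [y1 _ _ _ [b1 b2 b3 b4]]] := Qx.
have [g1 g1d g1E] := division_holo2 R Ux Ux (q ^+ d.+1) (qc1 x.2) Uxo Uxo (Uxq _) y1 D1.
have [g4 g4d g4E] := division_holo2_swap R Uy Uy (q ^+ l.+1) (qc4 x.1) Uyo Uyo (Uyq _) x4 D4.
(* Forced by the second component of the first entry: - q^(l+1) w2 t2 must equal zeta_2 = w2 f2. *)
pose s : CC R := - (q ^+ l.+1)^-1.
have sE : - q ^+ l.+1 * s = 1 by rewrite /s mulrNN divff.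
pose t := mkQuad g1 (fun p => s * f2 p) f3 g4.
exists t; split; last first.
  split; split=> -[z w] [/= hz hw].
  - by rewrite z1 //; ring.
  - by rewrite z2 //; transitivity (- q ^+ l.+1 * s * (w * f2 (z, w))); [ring|rewrite sE mul1r].
  - by rewrite z3 //; ring.
  - by rewrite (g4E (z, w)) //=; ring.
  - by rewrite (g1E (z, w)) //=; ring.
  - by rewrite e2 // /s !exprS; field; rewrite q0 !qn0.
  - by rewrite e3 //; ring.
  - by rewrite e4 //; ring.
split=> //=; first by apply: holo2M => //; exact: holo2_cst.
(* Each gluing condition of [t] is checked after multiplication by the coordinate, where it becomes
   a gluing condition of [x]. *)
split=> z hz /=.
- apply: (holo1_cancel0 R Ux (fun z => g1 (z, 0)) (fun z => s * f2 (z, 0)) z Uxo _ _ _ hz).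
  + exact: (holo2_slicel _ _ _ _ _ g1d).
  + by apply: holo1M; [exact: holo1_cst|exact: (holo2_slicel _ _ _ _ _ f2d)].
  move=> w hw; apply: (mulfI (qn0 d.+1)).
  have := b1 w hw; rewrite e2 // (g1E (w, 0)) //= => E.
  transitivity (- ((0 - q ^+ d.+1 * w) * g1 (w, 0))); first by ring.
  by rewrite E /s !exprS; field; rewrite q0 !qn0.
- apply: (holo1_cancel0 R Uy (fun z => f3 (z, 0)) (fun z => g4 (z, 0)) z Uyo _ _ _ hz).
  + exact: (holo2_slicel _ _ _ _ _ f3d).
  + exact: (holo2_slicel _ _ _ _ _ g4d).
  by move=> w hw; rewrite -z3 // a2 // (g4E (w, 0)) //= mulr0 subr0.
- apply: (holo1_cancel0 R Ux (fun z => g1 (0, z)) (fun z => f3 (0, z)) z Uxo _ _ _ hz).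
  + exact: (holo2_slicer _ _ _ _ _ g1d).
  + exact: (holo2_slicer _ _ _ _ _ f3d).
  by move=> w hw; rewrite -e3 // -b3 // (g1E (0, w)) //= mulr0 subr0.
apply: (holo1_cancel0 R Uy (fun z => s * f2 (0, z)) (fun z => g4 (0, z)) z Uyo _ _ _ hz).
- by apply: holo1M; [exact: holo1_cst|exact: (holo2_slicer _ _ _ _ _ f2d)].
- exact: (holo2_slicer _ _ _ _ _ g4d).
move=> w hw; have := a4 w hw; rewrite z2 // (g4E (0, w)) //= => E.
transitivity (s * (w * f2 (0, w))); first by ring.
by rewrite E -[RHS]mul1r -sE; ring.
Qed.

(** * A continuous right inverse and openness *)

(** The kernel element with [f2 = phi] and [f3 = 0]. Here [phi] extends [u] from the axes, while
    eta_1 and zeta_4 depend on one variable only, so that restriction to the lines followed by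
    division returns [u]. *)
Definition h1_section (u : Ofun R) : QQ R :=
  let phi (p : CC R * CC R) := u.1 p.1 + u.2 p.2 - u.1 0 in
  let k := q ^+ d / q ^+ l in
  (mkQuad (fun=> 0) (fun p => p.2 * phi p) (fun=> 0) (fun p => p.2 * u.2 p.2),
   mkQuad (fun p => k * (p.1 * u.1 p.1)) (fun p => k * (p.1 * phi p)) (fun=> 0) (fun=> 0)).

Lemma holo2_pr1 (V W : set (CC R)) (f : CC R -> CC R) : holo1 V f -> holo2 (V `*` W) (fun p => f p.1).
Proof. by move=> fd; apply: (holo2_comp1 _ _ _ _ _ fd (holo2_fst R _)) => p []. Qed.

Lemma holo2_pr2 (V W : set (CC R)) (f : CC R -> CC R) : holo1 W f -> holo2 (V `*` W) (fun p => f p.2).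
Proof. by move=> fd; apply: (holo2_comp1 _ _ _ _ _ fd (holo2_snd R _)) => p []. Qed.

Lemma h1_section_ker (u : Ofun R) : inOU u -> kerd1 (h1_section u).
Proof.
move=> [u1 u2 u0].
have phid : holo2 (Ux `*` Uy) (fun p => u.1 p.1 + u.2 p.2 - u.1 0).
  apply: holo2D; last exact: (holo2_cst R _ (- u.1 0)).
  by apply: holo2D; [exact: holo2_pr1|exact: holo2_pr2].
split.
  split; split=> /=; try exact: holo2_cst.
  - by apply: holo2M; [exact: holo2_snd|exact: phid].
  - by apply: holo2M; [exact: holo2_snd|exact: holo2_pr2].
  - by split=> z hz /=; rewrite ?mul0r // addrC addKr.
  - by apply: holo2M; [exact: holo2_cst|apply: holo2M; [exact: holo2_fst|exact: holo2_pr1]].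
  - by apply: holo2M; [exact: holo2_cst|apply: holo2M; [exact: holo2_fst|exact: phid]].
  by split=> z hz /=; rewrite ?mul0r ?mulr0 // u0 addrK.
split=> p hp /=; try by ring.
by field; rewrite qn0.
Qed.

Lemma h1_section_K (u : Ofun R) : inOU u -> eqO Ux Uy (h1_map (h1_section u)) u.
Proof.
move=> Ou; have [Qs _] := h1_section_ker _ Ou; have [u1 u2 u0] := Ou.
split=> z hz; rewrite /h1_map /=.
  have -> : dq R (diag1 (h1_section u)) 0 z = q ^+ d / q ^+ l * u.1 z.
    apply: (dq_factor R Ux _ (fun z => q ^+ d / q ^+ l * u.1 z) z Uxo Ux0 (diag1_holo _ Qs) _ _ hz).
      by apply: holo1M; [exact: holo1_cst|exact: u1].
    by move=> w hw; rewrite /diag1 /= mulrCA.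
  by field; rewrite !qn0.
by apply: (dq_factor R Uy _ u.2 z Uyo Uy0 (diag4_holo _ Qs) u2 _ hz).
Qed.

Lemma h1_map_open : lin_open Ux Uy kerd1 (@nbQQ R) inOU (@nbO R) (eqO Ux Uy) h1_map.
Proof.
move=> K L e [Kc KU] [Lc LU] e0.
have c1 : compact [set (0 : CC R)] by exact: compact_set1.
(* The origin is added because [phi] contains the term [u.1 0]. *)
pose K' := K `|` [set 0]; pose L' := L `|` [set 0].
have [N [N0 KN LN]] := compacts_bound _ _ _ Kc Lc.
pose k := `|q ^+ d / q ^+ l|; have k0 : 0 <= k by exact: normr_ge0.
(* 3 counts the terms of [phi], [N] bounds the coordinate factor, and [1 + k] dominates the scalars
   1 and [k]. *)
pose M := 3 * N * (1 + k).
have M0 : 0 < M by rewrite !mulr_gt0 // ltr_pwDl.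
exists K', L', (e / M); split.
- by split; [exact: compactU|move=> z [/KU|->]].
- by split; [exact: compactU|move=> z [/LU|->]].
- by rewrite divr_gt0.
move=> u Ou [h1 h2]; exists (h1_section u); split; [exact: h1_section_ker| |exact: h1_section_K].
have eM0 : 0 <= e / M by rewrite divr_ge0 // ltW.
have N0' := ltW N0.
have E : e = N * (3 * (e / M)) + k * (N * (3 * (e / M))).
  by rewrite {1}(_ : e = M * (e / M)); [rewrite /M; ring|rewrite mulrC divfK // gt_eqF].
have P1 : 0 <= N * (3 * (e / M)) by rewrite (mulr_ge0 N0') // (mulr_ge0 _ eM0).
have P2 : 0 <= k * (N * (3 * (e / M))) by rewrite mulr_ge0.
have B1 : N * (3 * (e / M)) <= e by rewrite [leRHS]E lerDl.
have B2 : k * (N * (3 * (e / M))) <= e by rewrite [leRHS]E lerDr.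
have one3 : e / M <= 3 * (e / M) by rewrite ler_peMl // ler1n.
have phiB p : K p.1 -> L p.2 -> `|u.1 p.1 + u.2 p.2 - u.1 0| <= 3 * (e / M).
  move=> Kp Lp; apply: le_trans (ler_normB _ _) _; apply: le_trans (lerD (ler_normD _ _) (lexx _)) _.
  have -> : 3 * (e / M) = e / M + e / M + e / M by ring.
  by apply: lerD; [apply: lerD; [apply: h1; left|apply: h2; left]|apply: h1; right].
have e0' := ltW e0.
split; split=> -[z w] [/= hz hw]; rewrite ?normr0 //.
- by apply: le_trans B1; rewrite normrM ler_pM //; [exact: LN|exact: (phiB (z, w))].
- apply: le_trans B1; rewrite normrM ler_pM //; first exact: LN.
  by apply: le_trans one3; apply: h2; left.
- apply: le_trans B2; rewrite normrM ler_wpM2l // normrM ler_pM //; first exact: KN.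
  by apply: le_trans one3; apply: h1; left.
apply: le_trans B2; rewrite normrM ler_wpM2l // normrM ler_pM //; first exact: KN.
exact: (phiB (z, w)).
Qed.

(** * Closedness of the image of [del0] *)

Lemma eq0_of_small (a : CC R) : (forall e : CC R, 0 < e -> `|a| <= e) -> a = 0.
Proof.
move=> h; apply/eqP; case: eqVneq => // a0.
have na : 0 < `|a| by rewrite normr_gt0.
have := h (`|a| / 2); rewrite divr_gt0 // => /(_ isT).
rewrite ler_pdivlMr // ger_pMr // => h2.
have : (1 : CC R) < 2 by rewrite ltr1n.
by move=> /lt_le_trans /(_ h2); rewrite ltxx.
Qed.

Lemma imd0_ker (x : QQ R) : inQQU x -> imd0 x -> kerd1 x.
Proof.
move=> Qx [z [Qz [[A1 A2 A3 A4] [B1 B2 B3 B4]]]]; split=> //.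
split=> p hp.
- by rewrite /= -A1 //=; ring.
- by rewrite /= -A2 // -B2 //= !exprS; ring.
- by rewrite /= -A3 // -B3 //=; ring.
- by rewrite /= -B4 //=; ring.
Qed.

(** The image is the kernel of [h1_map] inside the kernel of [del1]. Continuity of [del1] puts the
    limit into the latter, and continuity of [h1_map] then makes its class vanish. *)
Lemma imd0_closed : closedQQ Ux Uy imd0.
Proof.
move=> u x hu Qx lim_u.
have ku n : kerd1 (u n) by have [Qu iu] := hu n; exact: imd0_ker.
have uE n : subQQ (u n) x = addQQ (scaleQQ 1 (u n)) (scaleQQ (-1) x).
  rewrite /subQQ /subQ /addQQ /=; congr (addQ _ _, addQ _ _);
  case: (u n) => -[a1 a2 a3 a4] [b1 b2 b3 b4]; rewrite /scaleQ /=;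
  by congr mkQuad; apply/funext => p; rewrite mul1r.
have Qd n : inQQU (subQQ (u n) x).
  by have [[[Q1 Q2] _] [Q3 Q4]] := (ku n, Qx); split; exact: inQ_sub.
(* Both vanishing statements are pointwise, so compact sets of at most two points are enough to test
   them. *)
have ck (z w : CC R) : Ux z -> Ux w -> cpt_in Ux [set z; w].
  by move=> hz hw; split; [apply: compactU; exact: compact_set1|move=> v [->|->]].
have cl (z w : CC R) : Uy z -> Uy w -> cpt_in Uy [set z; w].
  by move=> hz hw; split; [apply: compactU; exact: compact_set1|move=> v [->|->]].
have kx : kerd1 x.
  split=> //.
  have near_ K L e : cpt_in Ux K -> cpt_in Uy L -> 0 < e ->
      exists n, nbQ K L e (del1 q l d (subQQ (u n) x)).
    move=> Kc Lc e0; have [K' [L' [dl [Kc' Lc' dl0 h]]]] := del1_continuous K L e Kc Lc e0.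
    have [n /(_ n (leqnn n)) hn] := lim_u K' L' dl Kc' Lc' dl0.
    by exists n; exact: h.
  split=> -[z w] [/= hz hw]; apply: eq0_of_small => e e0.
  - have [n [h _ _ _]] := near_ _ _ e (ck z w hz hw) (cl 0 0 Uy0 Uy0) e0.
    have [_ [k1 _ _ _]] := ku n.
    have := h (z, w); rewrite -normrN; set A := (X in (_ -> `|X| <= _) -> _).
    have -> : A = qc1 (del1 q l d x) (z, w) - qc1 (del1 q l d (u n)) (z, w) by rewrite /A /=; ring.
    by rewrite k1 // subr0; apply; split; [left|right].
  - have [n [_ h _ _]] := near_ _ _ e (ck z 0 hz Ux0) (cl w 0 hw Uy0) e0.
    have [_ [_ k1 _ _]] := ku n.
    have := h (z, w); rewrite -normrN; set A := (X in (_ -> `|X| <= _) -> _).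
    have -> : A = qc2 (del1 q l d x) (z, w) - qc2 (del1 q l d (u n)) (z, w) by rewrite /A /=; ring.
    by rewrite k1 // subr0; apply; split; left.
  - have [n [_ _ h _]] := near_ _ _ e (ck w 0 hw Ux0) (cl z 0 hz Uy0) e0.
    have [_ [_ _ k1 _]] := ku n.
    have := h (z, w); rewrite -normrN; set A := (X in (_ -> `|X| <= _) -> _).
    have -> : A = qc3 (del1 q l d x) (z, w) - qc3 (del1 q l d (u n)) (z, w) by rewrite /A /=; ring.
    by rewrite k1 // subr0; apply; split; left.
  have [n [_ _ _ h]] := near_ _ _ e (ck 0 0 Ux0 Ux0) (cl z w hz hw) e0.
  have [_ [_ _ _ k1]] := ku n.
  have := h (z, w); rewrite -normrN; set A := (X in (_ -> `|X| <= _) -> _).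
  have -> : A = qc4 (del1 q l d x) (z, w) - qc4 (del1 q l d (u n)) (z, w) by rewrite /A /=; ring.
  by rewrite k1 // subr0; apply; split; [left|right].
apply/(h1_map_eq0 _ kx).
have near_ K L e : cpt_in Ux K -> cpt_in Uy L -> 0 < e -> nbO K L e (h1_map x).
  move=> Kc Lc e0; have [K' [L' [dl [Kc' Lc' dl0 h]]]] := h1_map_continuous K L e Kc Lc e0.
  have [n /(_ n (leqnn n)) hn] := lim_u K' L' dl Kc' Lc' dl0.
  have kd := kerd1_comb 1 (-1) _ _ (ku n) kx.
  rewrite uE in hn; have [H1 H2] := h _ kd hn.
  have [C1 C2] := h1_map_comb 1 (-1) _ _ (ku n) kx.
  have [Z1 Z2] := (h1_map_eq0 _ (ku n)).2 (hu n).2.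
  split=> z hz.
    have hz' : Ux z by case: Kc => _; apply.
    have Y : (h1_map (u n)).1 z = 0 := Z1 z hz'.
    have := H1 z hz; rewrite C1 //.
    have -> : (lincombO 1 (h1_map (u n)) (-1) (h1_map x)).1 z = - (h1_map x).1 z.
      transitivity (1 * (h1_map (u n)).1 z + -1 * (h1_map x).1 z); first by [].
      by rewrite Y mulr0 add0r mulN1r.
    by rewrite normrN.
  have hz' : Uy z by case: Lc => _; apply.
  have Y : (h1_map (u n)).2 z = 0 := Z2 z hz'.
  have := H2 z hz; rewrite C2 //.
  have -> : (lincombO 1 (h1_map (u n)) (-1) (h1_map x)).2 z = - (h1_map x).2 z.
    transitivity (1 * (h1_map (u n)).2 z + -1 * (h1_map x).2 z); first by [].
    by rewrite Y mulr0 add0r mulN1r.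
  by rewrite normrN.
split=> z hz; apply: eq0_of_small => e e0.
  by have [h _] := near_ _ _ e (ck z 0 hz Ux0) (cl 0 0 Uy0 Uy0) e0; apply: h; left.
by have [_ h] := near_ _ _ e (ck 0 0 Ux0 Ux0) (cl z 0 hz Uy0) e0; apply: h; left.
Qed.

(** * Exactness at the last two places: H^2 and H^3 *)

(** Division forces zeta_1 = a1 and eta_4 = - a4. In each mixed component the value on the axis is
    supplied by [a1] or [a4], extended constantly in the second variable, and the remainder is a
    multiple of that variable, absorbed by [b2] or [b3]. The free components zeta_4 and eta_1 are
    constant extensions too. *)
Lemma ker_pi_im_del1 (z : Quad R) : inQU z -> eqO Ux Uy (pi_dl q d l z) (0, 0) ->
  exists x : QQ R, inQQU x /\ eqQ Ux Uy (del1 q l d x) z.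
Proof.
move=> Qz [P1 P4]; have [z1 z2 z3 z4 [c1 c2 c3 c4]] := Qz.
have [a1 a1d a1E] := division_holo2 R Ux Ux (q ^+ d) (qc1 z) Uxo Uxo (Uxq _) z1 P1.
have [a4 a4d a4E] := division_holo2_swap R Uy Uy (q ^+ l) (qc4 z) Uyo Uyo (Uyq _) z4 P4.
have zero1 : qc1 z (0, 0) = 0 by have := P1 0 Ux0; rewrite /= mulr0.
have axis (V W : set (CC R)) (F : CC R * CC R -> CC R) : open V -> open W -> W 0 -> holo2 (V `*` W) F ->
    exists2 G, holo2 (V `*` W) G & forall z w, V z -> W w -> F (z, w) = F (z, 0) + w * G (z, w).
  move=> Vo Wo W0 Fd.
  have [||G Gd GE] := division_holo2_0 R V W (fun p => F p - F (p.1, 0)) Vo Wo W0.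
  - move=> p Vp; apply: (@differentiableB _ _ (CC R)); first exact: Fd.
    apply: (holo2_pr1 V W (fun z => F (z, 0))) => //; exact: (holo2_slicel _ _ _ _ _ Fd).
  - by move=> v Vv; rewrite subrr.
  by exists G => // v w Vv Ww; rewrite -(GE (v, w)) //= addrC subrK.
have [b2 b2d b2E] := axis _ _ _ Uxo Uyo Uy0 z2.
have [b3 b3d b3E] := axis _ _ _ Uyo Uxo Ux0 z3.
pose k := (q ^+ l)^-1.
have kK : q ^+ l * k = 1 by rewrite divff.
(* [A1] and [A4] express the agreement of [z] along the axes and give the gluing of the chosen
   preimage. *)
have A1 w : Ux w -> a1 (0, w) = b3 (0, w).
  move=> hw; apply: (holo1_cancel0 R Ux (fun w => a1 (0, w)) (fun w => b3 (0, w)) w Uxo _ _ _ hw).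
  - exact: (holo2_slicer _ _ _ _ _ a1d).
  - exact: (holo2_slicer _ _ _ _ _ b3d).
  move=> s hs; have := c3 s hs; rewrite (a1E (0, s)) //= b3E // -c3 // zero1 add0r => <-; ring.
have A4 w : Uy w -> k * b2 (0, w) = - a4 (0, w).
  move=> hw; apply: (holo1_cancel0 R Uy (fun w => k * b2 (0, w)) (fun w => - a4 (0, w)) w Uyo _ _ _ hw).
  - by apply: holo1M; [exact: holo1_cst|exact: (holo2_slicer _ _ _ _ _ b2d)].
  - move=> s hs; apply: (@differentiableN _ _ (CC R)); exact: (holo2_slicer _ _ _ _ _ a4d).
  move=> s hs; have := c4 s hs; rewrite (a4E (0, s)) //= b2E // -c1 // zero1 add0r => E.
  rewrite mulrCA E; transitivity (- (q ^+ l * k) * (s * a4 (0, s))); first by ring.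
  by rewrite kK; ring.
pose x1 := mkQuad a1 (fun p => a1 (p.1, 0)) b3 (fun p => b3 (p.1, 0)).
pose x2 := mkQuad (fun p => k * b2 (p.1, 0)) (fun p => k * b2 p) (fun p => - a4 (p.1, 0)) (fun p => - a4 p).
have sl (V W Z : set (CC R)) F : holo2 (V `*` W) F -> W 0 -> holo2 (V `*` Z) (fun p => F (p.1, 0)).
  move=> Fd W0; apply: (holo2_pr1 V Z (fun z => F (z, 0))); exact: (holo2_slicel _ _ _ _ _ Fd).
exists (x1, x2); split.
  split; split.
  - exact: a1d.
  - exact: (sl _ _ _ _ a1d Ux0).
  - exact: b3d.
  - exact: (sl _ _ _ _ b3d Ux0).
  - by split=> s hs /=; [by []|by []|exact: A1|rewrite A1].
  - by apply: holo2M; [exact: holo2_cst|exact: (sl _ _ _ _ b2d Uy0)].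
  - by apply: holo2M; [exact: holo2_cst|exact: b2d].
  - move=> p hp; apply: (@differentiableN _ _ (CC R)); exact: (sl Uy Uy Ux a4 a4d Uy0 p hp).
  - move=> p hp; apply: (@differentiableN _ _ (CC R)); exact: a4d.
  - by split=> s hs /=; rewrite ?A4.
split=> -[v w] [/= hv hw].
- by rewrite (a1E (v, w)) //=; ring.
- rewrite [RHS]b2E // -c1 // (a1E (v, 0)) //=.
  transitivity ((0 - q ^+ d * v) * a1 (v, 0) + (q ^+ l * k) * (w * b2 (v, w))); first by ring.
  by rewrite kK mul1r.
- rewrite [RHS]b3E // c2 // (a4E (v, 0)) //=; ring.
- by rewrite (a4E (v, w)) //=; ring.
Qed.

(** [pi_dl] sees only the first and fourth components; the two mixed ones interpolate their values
    on the axes. *)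
Lemma pi_surjective (u : Ofun R) : inOU u -> exists z : Quad R, inQU z /\ eqO Ux Uy (pi_dl q d l z) u.
Proof.
move=> [u1 u2 u0].
exists (mkQuad (fun p => u.1 p.1) (fun p => u.1 p.1 + u.2 p.2 - u.1 0) (fun=> u.1 0) (fun p => u.2 p.2)).
split; last by split=> z hz.
split=> /=; [exact: holo2_pr1| |exact: holo2_cst|exact: holo2_pr2|].
  apply: holo2D; last exact: (holo2_cst R _ (- u.1 0)).
  by apply: holo2D; [exact: holo2_pr1|exact: holo2_pr2].
split=> z hz //=; [by rewrite -u0 addrK|by rewrite addrC addKr].
Qed.
End Sequence.

Theorem theorem4p1 (R : realType) (q : CC R) (Ux Uy : set (CC R)) (d l : nat) :
  0 < `|q| < 1 -> q_open q Ux -> q_open q Uy ->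
  let inQU := inQ Ux Uy in
  let inQQU := inQQ Ux Uy in
  let inOU := inO Ux Uy in
  let d0 := del0 q l d in
  let d1 := del1 q l d in
  let pi := pi_dl q d l in
  let kerd1 := fun x => inQQU x /\ eqQ Ux Uy (d1 x) (zeroQ R) in
  let imd0 := fun x => exists z, inQU z /\ eqQQ Ux Uy (d0 z) x in
  (* cochain complex of Frechet spaces: well-defined continuous maps, *)
  [/\ (forall z, inQU z -> inQQU (d0 z)),
      (forall x, inQQU x -> inQU (d1 x)),
      (forall z, inQU z -> inOU (pi z)) &
     [/\ lin_continuous Ux Uy inQU (@nbQ R) (@nbQQ R) d0,
      lin_continuous Ux Uy inQQU (@nbQQ R) (@nbQ R) d1 &
      lin_continuous Ux Uy inQU (@nbQ R) (@nbO R) pi]] /\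
  (* consecutive compositions vanish, *)
  (forall z, inQU z -> eqQ Ux Uy (d1 (d0 z)) (zeroQ R)) /\
  (forall x, inQQU x -> eqO Ux Uy (pi (d1 x)) (0, 0)) /\
  (* H^0 = 0 : d0 injective, *)
  (forall z, inQU z -> eqQQ Ux Uy (d0 z) (zeroQ R, zeroQ R) -> eqQ Ux Uy z (zeroQ R)) /\
  (* H^1 = ker d1 / im d0 is topologically isomorphic to O(U): there is a
     continuous linear open surjection ker d1 -> O(U) with kernel im d0, *)
  (exists Phi : QQ R -> Ofun R,
     [/\ forall x, kerd1 x -> inOU (Phi x),
         forall a b x y, kerd1 x -> kerd1 y ->
           eqO Ux Uy (Phi (addQQ (scaleQQ a x) (scaleQQ b y)))
                     (lincombO a (Phi x) b (Phi y)),
         lin_continuous Ux Uy kerd1 (@nbQQ R) (@nbO R) Phi &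
       [/\
         forall x, kerd1 x -> (eqO Ux Uy (Phi x) (0, 0) <-> imd0 x),
         forall u, inOU u -> exists x, kerd1 x /\ eqO Ux Uy (Phi x) u &
         lin_open Ux Uy kerd1 (@nbQQ R) inOU (@nbO R) (eqO Ux Uy) Phi]]) /\
  (* in particular im d0 is closed, *)
  closedQQ Ux Uy imd0 /\
  (* H^2 = 0 : im d1 = ker pi, *)
  (forall z, inQU z -> eqO Ux Uy (pi z) (0, 0) ->
     exists x, inQQU x /\ eqQ Ux Uy (d1 x) z) /\
  (* H^3 = 0 : pi surjective. *)
  (forall u, inOU u -> exists z, inQU z /\ eqO Ux Uy (pi z) u).
Proof.
move=> hq hx hy /=.
split.
  split; [exact: del0_inQQ|exact: del1_inQ|exact: pi_inO|split].
  - exact: del0_continuous.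
  - exact: del1_continuous.
  - exact: pi_continuous.
split; first by move=> z _; exact: del1_del0.
split; first by move=> x _; exact: pi_del1.
split; first exact: del0_injective.
split.
  exists (h1_map R q d l); split.
  - exact: h1_map_inO.
  - exact: h1_map_comb.
  - exact: h1_map_continuous.
  split.
  - exact: h1_map_eq0.
  - by move=> u Ou; exists (h1_section R q d l u); split; [exact: h1_section_ker|exact: h1_section_K].
  exact: h1_map_open.
split; first exact: imd0_closed.
split; [exact: ker_pi_im_del1|exact: pi_surjective].
Qed.
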